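(* In the QC setting, for every initial state $\mathbf{x}(0)\in\mathbb{R}^N$ and every $a>0$, $$\mathbb{P}\Big[\sup_{j\ge0}\|\mathbf{x}(j)\|>a\Big]\le\frac{\Big[2Nx_{\rm avg}^2(0)+\frac{4|\mathcal{M}|\Delta^2}{3N}\sum_{j\ge0}\alpha^2(j)\Big]^{1/2}}{a}+\frac{\big(1+\mathbf{x}(0)^T\overline{L}\mathbf{x}(0)\big)\prod_{j\ge0}(1+g(j))}{1+\frac{a^2}{2}\lambda_2(\overline{L})},$$ where $x_{\rm avg}(0)=\frac1N\mathbf{1}^T\mathbf{x}(0)$ and $g(j)=\alpha^2(j)\max\Big(\frac{\lambda_N^3(\overline{L})}{\lambda_2(\overline{L})}+\frac{4N^2\lambda_N(\overline{L})}{\lambda_2(\overline{L})},\ \frac{2|\mathcal{M}|\Delta^2\lambda_N(\overline{L})}{3}\Big)$.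
   Context: QC setting. Let $N\ge 2$; all random objects live on one probability space. $\{L(i)\}_{i\ge0}$ is an i.i.d. sequence of random graph Laplacians $L(i)=D(i)-A(i)$, where $A(i)$ is the adjacency matrix (symmetric, $\{0,1\}$-valued, zero diagonal) of a random undirected simple graph on $\{1,\dots,N\}$, $D(i)=\mathrm{diag}(d_1(i),\dots,d_N(i))$ with $d_n(i)$ the degree of node $n$, and $\Omega_n(i)=\{l:A_{nl}(i)=1\}$. Link failures at a given time may be arbitrarily correlated across edges. Let $\overline{L}=\mathbb{E}[L(i)]$ with eigenvalues $0=\lambda_1(\overline{L})\le\lambda_2(\overline{L})\le\cdots\le\lambda_N(\overline{L})$; assume $\lambda_2(\overline{L})>0$. $\mathcal{M}$ denotes the set of realizable edges (those appearing in the random graph with positive probability). Quantizer: step $\Delta>0$, $q(y)=k\Delta$ if $(k-\tfrac12)\Delta\le y<(k+\tfrac12)\Delta$, $k\in\mathbb{Z}$. Dither: $\{\nu_{nl}(i)\}$ i.i.d. uniform on $[-\Delta/2,\Delta/2)$, independent of $\{L(i)\}$. Weights: deterministic $\alpha(i)>0$ with $\sum_i\alpha(i)=\infty$, $\sum_i\alpha^2(i)<\infty$. QC recursion: $x_n(i+1)=(1-\alpha(i)d_n(i))x_n(i)+\alpha(i)\sum_{l\in\Omega_n(i)}q(x_l(i)+\nu_{nl}(i))$, with deterministic $\mathbf{x}(0)$. With $\varepsilon_{nl}(i)=q(x_l(i)+\nu_{nl}(i))-(x_l(i)+\nu_{nl}(i))$, $\Upsilon_n(i)=-\sum_{l\in\Omega_n(i)}\nu_{nl}(i)$,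 $\Psi_n(i)=-\sum_{l\in\Omega_n(i)}\varepsilon_{nl}(i)$, this reads $\mathbf{x}(i+1)=\mathbf{x}(i)-\alpha(i)[L(i)\mathbf{x}(i)+\Upsilon(i)+\Psi(i)]$. Conditionally on $\mathbf{x}(0),\{L(j),\Upsilon(j),\Psi(j)\}_{j<i}$ and $L(i)$, the $\varepsilon_{nl}(i)$ are i.i.d. uniform on $[-\Delta/2,\Delta/2)$ (as are the $\nu_{nl}(i)$). *)

(* Defs.v *)
From HB Require Import structures.
From mathcomp Require Import all_boot all_order all_algebra.
From mathcomp Require Import all_classical all_reals all_analysis.
Set Implicit Arguments. Unset Strict Implicit. Unset Printing Implicit Defensive.
Import Order.TTheory GRing.Theory Num.Theory.
Import numFieldNormedType.Exports.
Local Open Scope classical_set_scope.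
Local Open Scope ring_scope.

Definition graphT (N : nat) := {ffun 'I_N * 'I_N -> bool}.

Definition is_simple_graph (N : nat) (g : graphT N) : Prop :=
  forall n l : 'I_N, g (n, l) = g (l, n) /\ g (n, n) = false.

Definition degree (N : nat) (g : graphT N) (n : 'I_N) : nat :=
  #|[set l : 'I_N | g (n, l)]|.

Definition laplacian (R : pzRingType) (N : nat) (g : graphT N) : 'M[R]_N :=
  \matrix_(n, l) ((if n == l then (degree g n)%:R else 0) - (nat_of_bool (g (n, l)))%:R).

(* quantizer: q(y) = k D  iff  (k - 1/2) D <= y < (k + 1/2) D *)
Definition quant (R : realType) (D y : R) : R :=
  (Num.floor (y / D + 2^-1))%:~R * D.

Definition vnorm (R : realType) (N : nat) (x : 'I_N -> R) : R :=
  Num.sqrt (\sum_(n < N) x n ^+ 2).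

Fixpoint qc_state (R : realType) (T : Type) (N : nat) (D : R) (alpha : nat -> R)
  (A : nat -> T -> graphT N) (nu : nat -> 'I_N -> 'I_N -> T -> R)
  (x0 : 'I_N -> R) (i : nat) (w : T) : 'I_N -> R :=
  match i with
  | 0 => x0
  | i'.+1 =>
      let x := qc_state D alpha A nu x0 i' w in
      fun n => (1 - alpha i' * (degree (A i' w) n)%:R) * x n
               + alpha i' * \sum_(l < N | A i' w (n, l)) quant D (x l + nu i' n l w)
  end.

Definition mutually_independent (d : measure_display) (T : measurableType d)
  (R : realType) (P : probability T R) (I : eqType) (F : I -> set (set T)) : Prop :=
  forall (J : seq I), uniq J ->
  forall E : I -> set T, (forall i, i \in J -> F i (E i)) ->
  P (\big[setI/setT]_(i <- J) E i) = (\prod_(i <- J) P (E i))%E.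

Definition qc_events (R : realType) (T : Type) (N : nat)
  (A : nat -> T -> graphT N) (nu : nat -> 'I_N -> 'I_N -> T -> R)
  (k : (nat + (nat * 'I_N * 'I_N))%type) : set (set T) :=
  match k with
  | inl i => [set E | exists S : set (graphT N), E = A i @^-1` S]
  | inr p => let '(i, n, l) := p in
             [set E | exists B : set R, measurable B /\ E = nu i n l @^-1` B]
  end.

(* Lbar = E[L(i)] (entrywise expectation; the L(i) are identically distributed) *)
Definition Lbar (R : realType) (d : measure_display) (T : measurableType d)
  (P : probability T R) (N : nat) (A : nat -> T -> graphT N) : 'M[R]_N :=
  \matrix_(n, l) fine ('E_P[fun w => laplacian R (A 0%N w) n l]).

(* s is the nondecreasingly sorted list of the eigenvalues of M,
   counted with multiplicity: s = [lambda_1; ...; lambda_N]. *)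
Definition sorted_spectrum (R : realType) (N : nat) (M : 'M[R]_N) (s : seq R) : Prop :=
  [/\ size s = N, sorted <=%R s & char_poly M = \prod_(x <- s) ('X - x%:P)].

Definition n_realizable (R : realType) (d : measure_display) (T : measurableType d)
  (P : probability T R) (N : nat) (A : nat -> T -> graphT N) : nat :=
  #|[set e : 'I_N * 'I_N | (e.1 < e.2)%N && (0 < P (A 0%N @^-1` [set g : graphT N | g e]))%E]|.

Definition qc_g (R : realType) (N M : nat) (D l2 lN : R) (alpha : nat -> R) (j : nat) : R :=
  alpha j ^+ 2 * Num.max (lN ^+ 3 / l2 + 4 * (N%:R) ^+ 2 * lN / l2)
                         (2 * M%:R * D ^+ 2 * lN / 3).

Definition qc_bound (R : realType) (N M : nat) (D l2 lN : R) (alpha : nat -> R)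
  (Lb : 'M[R]_N) (x0 : 'I_N -> R) (a : R) : R :=
  let xavg := (N%:R)^-1 * \sum_(n < N) x0 n in
  let quad := \sum_(n < N) \sum_(l < N) x0 n * Lb n l * x0 l in
  Num.sqrt (2 * N%:R * xavg ^+ 2
            + 4 * M%:R * D ^+ 2 / (3 * N%:R) * limn (series (fun j => alpha j ^+ 2))) / a
  + (1 + quad) * limn (fun n => \prod_(j < n) (1 + qc_g N M D l2 lN alpha j))
    / (1 + a ^+ 2 / 2 * l2).

(* Main.v *)
Require Import Defs.
From HB Require Import structures.
From mathcomp Require Import all_boot all_order all_algebra.
From mathcomp Require Import all_classical all_reals all_analysis.
From mathcomp Require Import measurable_realfun.
From mathcomp Require Import complex spectral ring lra.
Import Order.TTheory GRing.Theory Num.Theory.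
Import numFieldNormedType.Exports.
Local Open Scope classical_set_scope.
Local Open Scope ring_scope.
Set Implicit Arguments. Unset Strict Implicit. Unset Printing Implicit Defensive.

(* If ||x|| > a then N avg(x)^2 >= a^2/2 or the centered part of x has squared
   norm > a^2/2.  The potentials avg^2 + v sum_(j >= i) alpha_j^2, with
   v = 2|M|Delta^2/(3N^2), and (1 + x^T Lbar x) prod_(j >= i) (1 + g_j) are
   nonnegative supermartingales, so their sum, suitably normalized, obeys a
   maximal inequality; the square root in the bound comes from t^2 <= t for
   t <= 1, the bound being trivial for t > 1.

   Conditional expectations are avoided: almost surely a dithered sample
   quant D (x_l + nu) is one of the two multiples of D around x_l, so that the
   first steps of the recursion follow one of finitely many paths.  By mutual
   independence the probability of a path is the product of the transition
   weights step_prob, and the maximal inequality is proved by induction on the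
   time horizon, conditioning on the path followed so far. *)

Definition quad (R : pzRingType) (N : nat) (M : 'M[R]_N) (x : 'I_N -> R) : R :=
  \sum_(n < N) \sum_(l < N) x n * M n l * x l.

(** * Unitary diagonalization of symmetric real matrices *)

Section Spectral.
Local Open Scope sesquilinear_scope.

Lemma char_poly_conj (F : fieldType) (n : nat) (P B : 'M[F]_n) :
  P \in unitmx -> char_poly (invmx P *m B *m P) = char_poly B.
Proof.
move=> Pu; rewrite /char_poly /char_poly_mx.
have Vu : map_mx (polyC (R:=F)) (invmx P) *m map_mx (polyC (R:=F)) P = 1%:M.
  by rewrite -map_mxM mulVmx // map_mx1.
have -> : 'X%:M - map_mx (polyC (R:=F)) (invmx P *m B *m P) =
   map_mx (polyC (R:=F)) (invmx P) *m ('X%:M - map_mx (polyC (R:=F)) B)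
   *m map_mx (polyC (R:=F)) P.
  rewrite mulmxBr mulmxBl !map_mxM scalar_mxC -[X in _ = X - _]mulmxA Vu.
  by rewrite mulmx1.
by rewrite !det_mulmx mulrAC -det_mulmx Vu det1 mul1r.
Qed.

(* The diagonalization is done over [R[i]], where the spectral theorem for
   normal matrices is available; the eigenvalues come out real. *)
Lemma symmetric_diagonalization (R : realType) (n : nat) (M : 'M[R]_n) :
  (forall i j, M i j = M j i) ->
  exists P : 'M[R[i]]_n, exists mu : 'I_n -> R,
  [/\ P \is unitarymx,
      map_mx (real_complex R) M =
        P ^t* *m diag_mx (\row_i (real_complex R (mu i))) *m P &
      char_poly M = \prod_i ('X - (mu i)%:P)].
Proof.
move=> Msym; set M' := map_mx (real_complex R) M.
have M'h : M' \is hermsymmx.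
  apply: realsym_hermsym.
    apply/is_hermitianmxP; rewrite expr0 scale1r map_mx_id //.
    by apply/matrixP => i j; rewrite !mxE Msym.
  by apply/mxOverP => i j; rewrite mxE; apply/complex_realP; exists (M i j).
have Pu := spectral_unitarymx M'.
have /orthomx_spectralP M'E := hermitian_normalmx M'h.
have muR := hermitian_spectral_diag_real M'h.
exists (spectralmx M'), (fun i => complex.Re (spectral_diag M' 0 i)).
have dE : \row_i (real_complex R (complex.Re (spectral_diag M' 0 i))) = spectral_diag M'.
  by apply/rowP => i; rewrite mxE RRe_real //; move: (mxOverP muR 0 i).
split=> //; first by rewrite dE -(invmx_unitary Pu).
apply: (@map_poly_inj _ _ (real_complex R)).
rewrite map_char_poly -/M' [in LHS]M'E char_poly_conj ?spectral_unit //.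
rewrite char_poly_trig ?diag_mx_is_trig // rmorph_prod.
apply: eq_bigr => i _; rewrite !mxE eqxx mulr1n rmorphB /= map_polyX map_polyC /=.
by rewrite RRe_real //; exact: (mxOverP muR).
Qed.

Section form.
Variables (R : realType) (N : nat) (M : 'M[R]_N).
Variables (P : 'M[R[i]]_N) (mu : 'I_N -> R).
Hypothesis Pu : P \is unitarymx.
Hypothesis ME : map_mx (real_complex R) M =
        P ^t* *m diag_mx (\row_i (real_complex R (mu i))) *m P.

(** Coordinates of [x] in the eigenvector basis given by the rows of the unitary matrix [P]; they
    are complex although [x] and the eigenvalues are real. *)
Definition spectral_coord (x : 'I_N -> R) : 'rV[R[i]]_N :=
  (\row_i real_complex R (x i)) *m P ^t*.

Definition spectral_weight (x : 'I_N -> R) (i : 'I_N) : R :=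
  complex.Re (spectral_coord x 0 i) ^+ 2 + complex.Im (spectral_coord x 0 i) ^+ 2.

Lemma spectral_weight_ge0 x i : 0 <= spectral_weight x i.
Proof. by rewrite addr_ge0 ?sqr_ge0. Qed.

Lemma spectral_weightE x i : real_complex R (spectral_weight x i) =
  spectral_coord x 0 i * (spectral_coord x 0 i)^*.
Proof. by rewrite -normCK -add_Re2_Im2. Qed.

Lemma conj_spectral_coord x :
  (spectral_coord x) ^t* = P *m (\row_i real_complex R (x i))^T.
Proof.
rewrite /spectral_coord trmx_mul map_mxM trmxCK; congr (_ *m _).
by apply/matrixP => i j; rewrite !mxE; apply: conjc_real.
Qed.

(** Parseval's identity: the adjoint of [P] cancels against [P] in the middle of the product. *)
Lemma dot_spectral x y : real_complex R (\sum_i x i * y i) =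
  \sum_i spectral_coord x 0 i * (spectral_coord y 0 i)^*.
Proof.
transitivity ((spectral_coord x *m (spectral_coord y)^t*) 0 0); last first.
  by rewrite mxE; apply: eq_bigr => i _; rewrite !mxE.
rewrite conj_spectral_coord /spectral_coord mulmxA -(invmx_unitary Pu) mulmxKV;
  last exact: unitarymx_unit.
by rewrite mxE rmorph_sum; apply: eq_bigr => i _; rewrite !mxE rmorphM.
Qed.

Lemma norm_spectral x : \sum_i x i ^+ 2 = \sum_i spectral_weight x i.
Proof.
apply: (@complexI R); under eq_bigr do rewrite expr2.
rewrite dot_spectral [in RHS]rmorph_sum.
by apply: eq_bigr => i _; rewrite [RHS]spectral_weightE.
Qed.

Lemma quad_spectral x : quad M x = \sum_i mu i * spectral_weight x i.
Proof.
apply: (@complexI R).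
transitivity ((spectral_coord x *m diag_mx (\row_i (real_complex R (mu i)))
   *m (spectral_coord x)^t*) 0 0).
  rewrite conj_spectral_coord /spectral_coord -!mulmxA
    (mulmxA (P^t*)) (mulmxA (P^t* *m _)) -ME.
  rewrite mxE rmorph_sum; apply: eq_bigr => i _.
  rewrite !mxE [LHS]rmorph_sum /= mulr_sumr; apply: eq_bigr => j _.
  by rewrite !mxE !rmorphM mulrA.
rewrite mxE [RHS]rmorph_sum; apply: eq_bigr => i _.
rewrite [RHS]rmorphM [X in _ = _ * X]spectral_weightE mul_mx_diag !mxE.
by rewrite -!mulrA mulrCA.
Qed.

(** Once [P] is cancelled on the right, the hypothesis on [e] says that each coordinate times its
    eigenvalue is zero. *)
Lemma spectral_coord_kernel e : (forall n, \sum_l e l * M l n = 0) ->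
  forall i, mu i != 0 -> spectral_coord e 0 i = 0.
Proof.
move=> eM i mui.
have : spectral_coord e *m diag_mx (\row_i (real_complex R (mu i))) *m P = 0.
  rewrite /spectral_coord -!mulmxA (mulmxA (P^t*)) -ME.
  apply/rowP => j; rewrite !mxE -[RHS](rmorph0 (real_complex R)) -(eM j).
  by rewrite [RHS]rmorph_sum; apply: eq_bigr => l _; rewrite !mxE rmorphM.
move/(congr1 (mulmx^~ (invmx P))); rewrite mulmxK ?unitarymx_unit // mul0mx.
move/rowP/(_ i); rewrite mul_mx_diag [LHS]mxE [RHS]mxE => /eqP; rewrite mulf_eq0 => /orP[/eqP //|].
by rewrite mxE => /eqP/(@complexI R)/eqP; rewrite (negbTE mui).
Qed.
End form.
End Spectral.

(** * Bounds on the quadratic form by the sorted eigenvalues *)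

Section Spectrum.
Variables (R : realType) (N : nat) (M : 'M[R]_N) (lam : seq R).
Hypothesis Msym : forall i j, M i j = M j i.
Hypothesis spec : sorted_spectrum M lam.

(** The list [lam] and the family [mu] are the roots of the same characteristic polynomial, so every
    [mu i] occurs in [lam] and is at most its last entry. *)
Lemma quad_le_max_eigenvalue x : quad M x <= lam`_N.-1 * \sum_i x i ^+ 2.
Proof.
have [P [mu [Pu ME cM]]] := symmetric_diagonalization Msym.
rewrite (quad_spectral ME) (norm_spectral Pu) mulr_sumr.
apply: ler_sum => i _; apply: ler_wpM2r; first exact: spectral_weight_ge0.
case: spec => sz so cl.
have /perm_mem/(_ (mu i)) : perm_eq lam (codom mu).
  by apply: prod_XsubC_eq; rewrite -cl cM big_map enumT.
rewrite codom_f => /(nthP 0)[k]; rewrite sz => kN <-.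
have N0 : (0 < N)%N by apply: leq_trans kN.
apply: (sorted_leq_nth le_trans le_refl 0 so); rewrite ?inE ?sz ?prednK //.
by rewrite -ltnS prednK.
Qed.

(* As [lam`_1 > 0], the kernel is the line spanned by the all-one vector. *)
Lemma quad_ge_eigenvalue1 x : (2 <= N)%N -> 0 < lam`_1 ->
  (forall n, \sum_l M l n = 0) -> \sum_i x i = 0 ->
  lam`_1 * \sum_i x i ^+ 2 <= quad M x.
Proof.
move=> N2 l1 M1 x1.
have [P [mu [Pu ME cM]]] := symmetric_diagonalization Msym.
rewrite (quad_spectral ME) (norm_spectral Pu) mulr_sumr.
have ker1 : forall i, mu i != 0 -> spectral_coord P (fun=> 1) 0 i = 0.
  by apply: (spectral_coord_kernel Pu ME) => n; under eq_bigr do rewrite mul1r.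
(* The all-one vector has squared norm [N], hence some nonzero coordinate [i0]; by [ker1] the
   eigenvalue there is zero. *)
have [i0 v0] : exists i0, spectral_coord P (fun=> 1) 0 i0 != 0.
  apply/existsP; apply: contraT; rewrite negb_exists => /forallP v0.
  have := norm_spectral Pu (fun=> 1).
  rewrite (eq_bigr (fun=> 1)) => [|i _]; last by rewrite expr1n.
  rewrite [RHS]big1 => [|i _]; last first.
    by move: (v0 i); rewrite negbK /spectral_weight => /eqP ->; rewrite /= expr0n addr0.
  by rewrite sumr_const card_ord => /eqP; rewrite pnatr_eq0; case: N N2.
have mu0 : mu i0 = 0.
  by apply/eqP; apply: contraT => /ker1 /eqP; rewrite (negbTE v0).
case: spec => sz so cl.
have pe : perm_eq lam (codom mu).
  by apply: prod_XsubC_eq; rewrite -cl cM big_map enumT.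
(* In a sorted list only the head can lie strictly below the second entry. The eigenvalue
   [mu i0 = 0] fills that place, so all the others are at least the second entry. *)
have c1 : (count (fun z => z < lam`_1)%R lam <= 1)%N.
  case El : lam sz => [|z0 s] //= _.
  rewrite -[leqRHS]addn0 leq_add ?leq_b1 // leqn0.
  rewrite -leqn0 leqNgt -has_count; apply/hasPn => y ys.
  rewrite -leNgt; have [k ks <-] := nthP 0 ys.
  have -> : s`_k = lam`_k.+1 by rewrite El.
  have -> : s`_0 = lam`_1 by rewrite El.
  rewrite El in so *; apply: (sorted_leq_nth le_trans le_refl 0 so) => //=; rewrite ?inE /= ?ltnS //.
  by case: (s) ks.
have big_mu i : i != i0 -> lam`_1 <= mu i.
  move=> ii0; rewrite leNgt; apply/negP => mui.
  move: c1; rewrite (permP pe) count_map -size_filter.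
  rewrite -/(enum_mem _) => c1.
  have : (size [:: i; i0] <= size [seq x <- enum 'I_N | (mu x < lam`_1)%R])%N.
    apply: uniq_leq_size => /=; first by rewrite inE ii0.
    by move=> j; rewrite !inE mem_filter mem_enum /= andbT => /orP[] /eqP -> //; rewrite mu0.
  by move/leq_trans => /(_ _ c1).
apply: ler_sum => i _; have [->|ii0] := eqVneq i i0; last first.
  by apply: ler_wpM2r; [exact: spectral_weight_ge0|exact: big_mu].
(* The all-one vector has [i0] as its only nonzero coordinate, so orthogonality to it forces
   coordinate [i0] of [x] to vanish. *)
suff -> : spectral_weight P x i0 = 0 by rewrite !mulr0.
have := dot_spectral Pu x (fun=> 1).
under eq_bigr do rewrite mulr1.
rewrite x1 [LHS]rmorph0 (bigD1 i0) //= [X in _ + X]big1 ?addr0; last first.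
  move=> j ji0; rewrite ker1 ?rmorph0 ?mulr0 //.
  by rewrite gt_eqF // (lt_le_trans l1) // big_mu.
move=> /esym/eqP; rewrite mulf_eq0 conjC_eq0 (negbTE v0) orbF => /eqP u0.
by rewrite /spectral_weight u0 /= expr0n addr0.
Qed.
End Spectrum.

(** * Moments of linear forms under a product of two-point laws *)

Section ProductBernoulli.
Variables (R : realDomainType) (I : finType) (w : I -> bool -> R).
Hypothesis w1 : forall e, \sum_c w e c = 1.

(** Distributivity: under product weights, the mean of a product of functions of separate
    coordinates factors. The marginals below take all but one or two of the [h e] equal to 1. *)
Lemma sum_ffun_prod (h : I -> bool -> R) :
  \sum_(b : {ffun I -> bool}) (\prod_e w e (b e)) * \prod_e h e (b e) =
  \prod_e \sum_c w e c * h e c.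
Proof.
by rewrite bigA_distr_bigA; apply: eq_bigr => b _; rewrite -big_split.
Qed.

Lemma sum_ffun_prod1 : \sum_(b : {ffun I -> bool}) \prod_e w e (b e) = 1.
Proof.
have := sum_ffun_prod (fun=> fun=> 1); rewrite [RHS]big1 => [H|e _].
  rewrite -[RHS]H.
  by apply: eq_bigr => b _; rewrite [X in _ * X]big1 ?mulr1.
by rewrite -[RHS](w1 e); apply: eq_bigr => c _; rewrite mulr1.
Qed.

Lemma sum_ffun_prod_at e0 (h : bool -> R) :
  \sum_(b : {ffun I -> bool}) (\prod_e w e (b e)) * h (b e0) =
  \sum_c w e0 c * h c.
Proof.
have := sum_ffun_prod (fun e c => if e == e0 then h c else 1).
rewrite [RHS](bigD1 e0) //= eqxx [X in _ * X]big1 ?mulr1 => [<-|e /negbTE ee0].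
  apply: eq_bigr => b _; rewrite [X in _ = _ * X](bigD1 e0) //= eqxx.
  by rewrite [X in _ = _ * (_ * X)]big1 ?mulr1 // => e /negbTE ->.
by rewrite ee0 -[RHS](w1 e); apply: eq_bigr => c _; rewrite mulr1.
Qed.

Lemma sum_ffun_prod_at2 e0 e1 (h k : bool -> R) : e1 != e0 ->
  \sum_(b : {ffun I -> bool}) (\prod_e w e (b e)) * (h (b e0) * k (b e1)) =
  (\sum_c w e0 c * h c) * (\sum_c w e1 c * k c).
Proof.
move=> e10.
have := sum_ffun_prod (fun e c => if e == e0 then h c else
                                  if e == e1 then k c else 1).
rewrite [RHS](bigD1 e0) //= eqxx (bigD1 e1) //= (negbTE e10) eqxx.
rewrite [X in _ * (_ * X)]big1 ?mulr1 => [<-|e /andP[/negbTE ee0 /negbTE ee1]].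
  apply: eq_bigr => b _; rewrite [X in _ = _ * X](bigD1 e0) //= eqxx.
  rewrite [X in _ = _ * (_ * X)](bigD1 e1) //= (negbTE e10) eqxx.
  by rewrite [X in _ = _ * (_ * (_ * X))]big1 ?mulr1 // => e /andP[/negbTE -> /negbTE ->].
by rewrite ee0 ee1 -[RHS](w1 e); apply: eq_bigr => c _; rewrite mulr1.
Qed.

Variables (eta : I -> bool -> R) (v : R).
Hypothesis eta0 : forall e, \sum_c w e c * eta e c = 0.
Hypothesis etav : forall e, \sum_c w e c * eta e c ^+ 2 <= v.

Lemma mean_linear_noise (a : I -> R) :
  \sum_(b : {ffun I -> bool}) (\prod_e w e (b e)) * (\sum_e a e * eta e (b e)) = 0.
Proof.
under eq_bigr do rewrite mulr_sumr.
rewrite exchange_big big1 // => e _.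
under eq_bigr do rewrite mulrCA.
by rewrite -mulr_sumr (sum_ffun_prod_at e (eta e)) eta0 mulr0.
Qed.

(** In the expanded square the cross terms factor and vanish, each [eta e] having mean zero; only
    the diagonal remains. *)
Lemma variance_linear_noise (a : I -> R) :
  \sum_(b : {ffun I -> bool}) (\prod_e w e (b e)) * (\sum_e a e * eta e (b e)) ^+ 2
  <= v * \sum_e a e ^+ 2.
Proof.
have -> : \sum_(b : {ffun I -> bool}) (\prod_e w e (b e)) *
    (\sum_e a e * eta e (b e)) ^+ 2 =
  \sum_e \sum_f a e * a f * \sum_(b : {ffun I -> bool})
    (\prod_e w e (b e)) * (eta e (b e) * eta f (b f)).
  rewrite (eq_bigr (fun b : {ffun I -> bool} => \sum_e \sum_f
    (\prod_e w e (b e)) * ((a e * eta e (b e)) * (a f * eta f (b f))))); last first.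
    move=> b _; rewrite expr2 big_distrlr /= mulr_sumr.
    by apply: eq_bigr => e _; rewrite mulr_sumr.
  rewrite exchange_big; apply: eq_bigr => e _ /=.
  rewrite exchange_big; apply: eq_bigr => f _ /=.
  rewrite mulr_sumr; apply: eq_bigr => b _; ring.
rewrite mulr_sumr; apply: ler_sum => e _.
rewrite (bigD1 e) //= [X in _ + X]big1 ?addr0 => [|f fe]; last first.
  by rewrite (sum_ffun_prod_at2 (eta e) (eta f) fe) eta0 mul0r mulr0.
rewrite (sum_ffun_prod_at e (fun c => eta e c * eta e c)) mulrC -expr2.
by apply: ler_wpM2r; [exact: sqr_ge0|exact: etav].
Qed.
End ProductBernoulli.

Lemma sum_const_ord (R : pzSemiRingType) (N : nat) (c : R) : \sum_(i < N) c = N%:R * c.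
Proof. by rewrite sumr_const card_ord mulr_natl. Qed.

(** * Bilinear forms, the average and the centered part *)

Section Bilinear.
Variables (R : realFieldType) (N : nat).
Implicit Types (M : 'M[R]_N) (x y z : 'I_N -> R).

Definition mulv M x : 'I_N -> R := fun n => \sum_l M n l * x l.

Definition bil M x y : R := \sum_n x n * mulv M y n.

Lemma quadE M x : quad M x = bil M x x.
Proof.
apply: eq_bigr => n _; rewrite /mulv mulr_sumr.
by apply: eq_bigr => l _; rewrite mulrA.
Qed.

Lemma mulvD M x y a : mulv M (fun n => x n + a * y n) = fun n => mulv M x n + a * mulv M y n.
Proof.
apply/funext => n; rewrite /mulv mulr_sumr -big_split /=.
by apply: eq_bigr => l _; ring.
Qed.

Lemma bil_sym M x y : (forall i j, M i j = M j i) -> bil M x y = bil M y x.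
Proof.
move=> Ms; rewrite /bil /mulv.
under eq_bigr do rewrite mulr_sumr.
under [RHS]eq_bigr do rewrite mulr_sumr.
rewrite exchange_big; apply: eq_bigr => i _; apply: eq_bigr => j _ /=.
by rewrite (Ms i j); ring.
Qed.

Lemma quadD M x y a : (forall i j, M i j = M j i) ->
  quad M (fun n => x n + a * y n) =
  quad M x + 2 * a * bil M y x + a ^+ 2 * quad M y.
Proof.
move=> Ms; rewrite !quadE {1}/bil mulvD.
under eq_bigr do rewrite mulrDl !mulrDr.
rewrite big_split !big_split /= -/(bil M x x).
have -> : \sum_i x i * (a * mulv M y i) = a * bil M y x.
  by rewrite (bil_sym y x Ms) mulr_sumr; apply: eq_bigr => i _; ring.
have -> : \sum_i a * y i * mulv M x i = a * bil M y x.
  by rewrite mulr_sumr; apply: eq_bigr => i _; ring.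
have -> : \sum_i a * y i * (a * mulv M y i) = a ^+ 2 * bil M y y.
  by rewrite mulr_sumr; apply: eq_bigr => i _; ring.
ring.
Qed.

(** Cauchy-Schwarz against the all-one vector, from the nonnegativity of the sum of all squares
    [(x i - x j) ^+ 2]. *)
Lemma sqr_sum_le x : (\sum_n x n) ^+ 2 <= N%:R * \sum_n x n ^+ 2.
Proof.
have : 0 <= \sum_i \sum_j (x i - x j) ^+ 2.
  by apply: sumr_ge0 => i _; apply: sumr_ge0 => j _; exact: sqr_ge0.
have -> : \sum_i \sum_j (x i - x j) ^+ 2 =
   2 * (N%:R * \sum_n x n ^+ 2 - (\sum_n x n) ^+ 2).
  rewrite (eq_bigr (fun i => (N%:R * x i ^+ 2 + (- 2 * \sum_j x j) * x i)
    + \sum_j x j ^+ 2)); last first.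
    move=> i _; rewrite (eq_bigr (fun j => (x i ^+ 2 + (- 2 * x i) * x j) + x j ^+ 2)); last first.
      by move=> j _; ring.
    rewrite big_split big_split /= sum_const_ord.
    by rewrite -mulr_sumr; congr (_ + _); ring.
  rewrite big_split big_split /= -!mulr_sumr sum_const_ord.
  ring.
by rewrite pmulr_rge0 // subr_ge0.
Qed.

Definition avg x : R := N%:R^-1 * \sum_n x n.
(** Written as [x n + a * y n] with [y] constantly -1, so that [mulvD] applies as it stands. *)
Definition centered x : 'I_N -> R := fun n => x n + avg x * (- 1).

Lemma sum_centered x : (0 < N)%N -> \sum_n centered x n = 0.
Proof.
move=> N0; rewrite big_split /= sum_const_ord /avg.
have : N%:R != 0 :> R by rewrite pnatr_eq0 -lt0n.
by move=> ?; field.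
Qed.

Lemma sqnorm_centered x : (0 < N)%N ->
  \sum_n x n ^+ 2 = N%:R * avg x ^+ 2 + \sum_n centered x n ^+ 2.
Proof.
move=> N0; have NN : N%:R != 0 :> R by rewrite pnatr_eq0 -lt0n.
rewrite [in RHS](eq_bigr (fun n => (x n ^+ 2 + (- 2 * avg x) * x n) + avg x ^+ 2)); last first.
  by move=> n _; rewrite /centered; ring.
rewrite !big_split /= sum_const_ord -mulr_sumr /avg.
by field.
Qed.

Lemma mulv_centered M x : (forall n, \sum_l M n l = 0) -> mulv M (centered x) = mulv M x.
Proof.
move=> M0; rewrite /centered (mulvD M x (fun=> -1)); apply/funext => n.
rewrite {2}/mulv -mulr_suml M0; ring.
Qed.

Lemma quad_centered M x : (forall i j, M i j = M j i) ->
  (forall n, \sum_l M n l = 0) -> quad M (centered x) = quad M x.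
Proof.
move=> Ms M0; rewrite !quadE {1}/bil mulv_centered // -/(bil M _ _).
by rewrite bil_sym // {1}/bil mulv_centered // -/(bil M _ _) bil_sym.
Qed.
End Bilinear.

(** * Elementary properties of graph Laplacians *)

Section LaplacianBounds.
Variables (R : realFieldType) (N : nat) (g : graphT N).
Implicit Types (x : 'I_N -> R).

Lemma degreeE n : (degree g n)%:R = \sum_l (g (n, l))%:R :> R.
Proof.
rewrite /degree -sum1_card natr_sum big_mkcond /=; apply: eq_bigr => l _.
have -> : (l \in [set l : 'I_N | g (n, l)]) = g (n, l).
  by apply/idP/idP => [/set_mem|/mem_set].
by case: (g _).
Qed.

Lemma mulv_laplacian x n :
  mulv (laplacian R g) x n = (degree g n)%:R * x n - \sum_l (g (n, l))%:R * x l.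
Proof.
rewrite /mulv; under eq_bigr do rewrite mxE mulrBl.
rewrite sumrB; congr (_ - _); rewrite (bigD1 n) //= eqxx big1 ?addr0 // => l.
by rewrite eq_sym => /negbTE ->; rewrite mul0r.
Qed.

Lemma laplacian_row_sum n : \sum_l laplacian R g n l = 0.
Proof.
have := mulv_laplacian (fun=> 1) n; rewrite /mulv mulr1 degreeE.
under eq_bigr do rewrite mulr1.
by under [X in _ - X]eq_bigr do rewrite mulr1; rewrite subrr.
Qed.

Lemma laplacian_sym : is_simple_graph g -> forall n l, laplacian R g n l = laplacian R g l n.
Proof.
move=> sg n l; rewrite !mxE; have [-> _] := sg n l.
by rewrite eq_sym; case: eqP => // ->.
Qed.

Lemma sum_mulv_laplacian x : is_simple_graph g -> \sum_n mulv (laplacian R g) x n = 0.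
Proof.
move=> sg; rewrite /mulv exchange_big big1 // => l _.
rewrite -mulr_suml (eq_bigr (fun n => laplacian R g l n)) ?laplacian_row_sum ?mul0r // => n _.
exact: laplacian_sym.
Qed.

(** From (p - q)^2 <= 2 p^2 + 2 q^2, with p the degree term and q the neighbour sum: degrees are at
    most [N], Cauchy-Schwarz bounds q, and each half contributes 2 N^2 times the squared norm. *)
Lemma sqnorm_laplacian_le x :
  \sum_n mulv (laplacian R g) x n ^+ 2 <= 4 * N%:R ^+ 2 * \sum_n x n ^+ 2.
Proof.
set S := \sum_n x n ^+ 2.
have S0 : 0 <= S by apply: sumr_ge0 => n _; exact: sqr_ge0.
have h n : mulv (laplacian R g) x n ^+ 2 <= 2 * N%:R ^+ 2 * x n ^+ 2 + 2 * (N%:R * S).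
  rewrite mulv_laplacian.
  have dN : (degree g n)%:R ^+ 2 <= N%:R ^+ 2 :> R.
    rewrite ler_sqr ?nnegrE ?ler0n // ler_nat.
    by rewrite (leq_trans (max_card _)) // card_ord.
  have cs : (\sum_l (g (n, l))%:R * x l) ^+ 2 <= N%:R * S.
    apply: (le_trans (sqr_sum_le _)); apply: ler_wpM2l; first exact: ler0n.
    apply: ler_sum => l _; case: (g _); rewrite ?mul1r // mul0r expr0n.
    exact: sqr_ge0.
  have dx := ler_wpM2r (sqr_ge0 (x n)) dN.
  have := sqr_ge0 ((degree g n)%:R * x n + \sum_l (g (n, l))%:R * x l).
  move: cs dx; set p := (degree g n)%:R; set q := \sum_l _; nra.
apply: (le_trans (ler_sum _ (fun n _ => h n))).
rewrite big_split /= -mulr_sumr sum_const_ord -/S.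
by rewrite le_eqVlt; apply/orP; left; apply/eqP; ring.
Qed.
End LaplacianBounds.

(** * One step of the recursion for a fixed graph *)

Section Drift.
Variables (R : realType) (N : nat) (D : R).
Hypothesis D0 : 0 < D.

Definition cell_frac (y : R) : R := y / D - (Num.floor (y / D))%:~R.

(* Up to a null event, a dithered sample [quant D (y + nu)] is one of the two
   multiples of [D] around [y], the upper one having probability [cell_frac y]. *)
Definition round_to (y : R) (c : bool) : R :=
  ((Num.floor (y / D))%:~R + (c : nat)%:R) * D.

Definition round_prob (y : R) (c : bool) : R :=
  if c then cell_frac y else 1 - cell_frac y.

Lemma cell_frac_itv y : 0 <= cell_frac y < 1.
Proof.
have := floor_itv (y / D); rewrite /cell_frac intrD => /andP[].
by move=> h1 h2; apply/andP; split; lra.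
Qed.

Lemma round_prob_ge0 y c : 0 <= round_prob y c.
Proof. by have /andP[] := cell_frac_itv y; case: c => /= ? ?; lra. Qed.

Lemma sum_bool (F : bool -> R) : \sum_c F c = F true + F false.
Proof. by rewrite big_bool. Qed.

Lemma sum_round_prob y : \sum_c round_prob y c = 1.
Proof. by rewrite sum_bool /=; lra. Qed.

Lemma mean_round y : \sum_c round_prob y c * (round_to y c - y) = 0.
Proof.
rewrite sum_bool /round_prob /round_to /cell_frac /= addr0; field.
by rewrite gt_eqF.
Qed.

(** With f = [cell_frac y] the variance is D^2 f (1 - f), at most D^2 / 4. The constant D^2 / 3 is
    the one that, summed over both orientations of every realizable edge, gives 2 |M| D^2 / 3. *)
Lemma variance_round y :
  \sum_c round_prob y c * (round_to y c - y) ^+ 2 <= D ^+ 2 / 3.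
Proof.
rewrite sum_bool.
have -> : round_prob y true * (round_to y true - y) ^+ 2 +
  round_prob y false * (round_to y false - y) ^+ 2 =
  D ^+ 2 * (cell_frac y * (1 - cell_frac y)).
  rewrite /round_prob /round_to /cell_frac /= addr0; field.
  by rewrite gt_eqF.
apply: ler_wpM2l; first exact: sqr_ge0.
by have := sqr_ge0 (cell_frac y - 2^-1); nra.
Qed.

(** The sampled graph and, for every ordered pair, whether its sample is rounded up. Non-edges carry
    a bit too, which makes the rounding weight the same product over all pairs whatever the
    graph. *)
Definition stepT := (graphT N * {ffun 'I_N * 'I_N -> bool})%type.

Definition next_state (al : R) (x : 'I_N -> R) (s : stepT) : 'I_N -> R :=
  fun n => (1 - al * (degree s.1 n)%:R) * x n
           + al * \sum_(l < N | s.1 (n, l)) round_to (x l) (s.2 (n, l)).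

(** Ordered pairs are counted, so an undirected edge counts twice; hence the factor 2 in front of
    [E] later. *)
Definition edge_count (g : graphT N) : R := \sum_e (g e)%:R.

Definition round_noise (x : 'I_N -> R) (s : stepT) : 'I_N -> R :=
  fun n => \sum_l (s.1 (n, l))%:R * (round_to (x l) (s.2 (n, l)) - x l).

Lemma next_stateE al x s : next_state al x s =
  fun n => (x n + (- al) * mulv (laplacian R s.1) x n) + al * round_noise x s n.
Proof.
apply/funext => n; rewrite /next_state mulv_laplacian /round_noise.
have -> : \sum_l (s.1 (n, l))%:R * (round_to (x l) (s.2 (n, l)) - x l) =
  \sum_(l | s.1 (n, l)) round_to (x l) (s.2 (n, l)) - \sum_l (s.1 (n, l))%:R * x l.
  rewrite [X in _ = X - _]big_mkcond -sumrB; apply: eq_bigr => l _ /=.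
  by case: (s.1 _); rewrite ?mul1r ?mul0r ?subr0.
ring.
Qed.

(** Puts the noise in the form of a sum over ordered pairs, as required by [mean_linear_noise] and
    [variance_linear_noise]. *)
Lemma linear_round_noise (c : 'I_N -> R) x s :
  \sum_n c n * round_noise x s n =
  \sum_e (c e.1 * (s.1 e)%:R) * (round_to (x e.2) (s.2 e) - x e.2).
Proof.
rewrite (eq_bigr (fun n => \sum_l (c n * (s.1 (n, l))%:R) *
   (round_to (x l) (s.2 (n, l)) - x l))); last first.
  by move=> n _; rewrite mulr_sumr; apply: eq_bigr => l _; rewrite mulrA.
by rewrite pair_bigA; apply: eq_bigr => -[n l] _.
Qed.

Definition round_weight (x : 'I_N -> R) (b : {ffun 'I_N * 'I_N -> bool}) : R :=
  \prod_e round_prob (x e.2) (b e).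

Lemma round_weight_ge0 x b : 0 <= round_weight x b.
Proof. by apply: prodr_ge0 => e _; exact: round_prob_ge0. Qed.

Lemma sum_round_weight x : \sum_b round_weight x b = 1.
Proof.
exact: (sum_ffun_prod1 (fun e => sum_round_prob (x e.2))).
Qed.

Lemma mean_round_noise x g (c : 'I_N -> R) :
  \sum_b round_weight x b * \sum_n c n * round_noise x (g, b) n = 0.
Proof.
under eq_bigr do rewrite linear_round_noise /=.
exact: (mean_linear_noise (fun e => sum_round_prob (x e.2)) (fun e => mean_round (x e.2))).
Qed.

Lemma variance_round_noise x g (c : 'I_N -> R) :
  \sum_b round_weight x b * (\sum_n c n * round_noise x (g, b) n) ^+ 2 <=
  D ^+ 2 / 3 * \sum_e c e.1 ^+ 2 * (g e)%:R.
Proof.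
under eq_bigr do rewrite linear_round_noise /=.
rewrite (eq_bigr (fun e => (c e.1 * (g e)%:R) ^+ 2) (r := index_enum (prod 'I_N 'I_N))); last first.
  by move=> e _; case: (g e); rewrite !(mulr0, mulr1, expr0n).
exact: (variance_linear_noise (fun e => sum_round_prob (x e.2))
  (fun e => mean_round (x e.2)) (fun e => variance_round (x e.2))).
Qed.

(** The variance bound is applied to each coordinate functional [c n0]; an ordered pair feeds only
    the coordinate of its first component, so it is counted once. *)
Lemma sqnorm_round_noise x g :
  \sum_b round_weight x b * \sum_n round_noise x (g, b) n ^+ 2 <=
  D ^+ 2 / 3 * edge_count g.
Proof.
under eq_bigr do rewrite mulr_sumr.
rewrite exchange_big /=.
pose c (n0 : 'I_N) := fun n : 'I_N => (n == n0)%:R : R.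
have cE n0 b : round_noise x (g, b) n0 = \sum_n c n0 n * round_noise x (g, b) n.
  rewrite (bigD1 n0) //= /c eqxx mul1r big1 ?addr0 // => n /negbTE ->.
  by rewrite mul0r.
apply: (@le_trans _ _ (\sum_n0 D ^+ 2 / 3 * \sum_e c n0 e.1 ^+ 2 * (g e)%:R)).
  apply: ler_sum => n0 _; apply: le_trans (variance_round_noise x g (c n0)).
  by under eq_bigr do rewrite cE.
rewrite -mulr_sumr exchange_big /= /edge_count.
rewrite (eq_bigr (fun e : 'I_N * 'I_N => (g e)%:R)) // => e _.
rewrite (bigD1 e.1) //= /c eqxx expr1n mul1r big1 ?addr0 // => n.
by rewrite eq_sym => /negbTE ->; rewrite expr0n mul0r.
Qed.

(** The Laplacian of a simple graph has zero column sums, so the total changes only by the noise,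
    which is centered and has variance at most the coefficient of [al ^+ 2]. *)
Lemma sum_next_sqr al x g : is_simple_graph g ->
  \sum_b round_weight x b * (\sum_n next_state al x (g, b) n) ^+ 2 <=
  (\sum_n x n) ^+ 2 + al ^+ 2 * (D ^+ 2 / 3 * edge_count g).
Proof.
move=> sg.
have E b : (\sum_n next_state al x (g, b) n) ^+ 2 = (\sum_n x n) ^+ 2
   + ((2 * al * \sum_n x n) * \sum_n 1 * round_noise x (g, b) n
      + al ^+ 2 * (\sum_n 1 * round_noise x (g, b) n) ^+ 2).
  have -> : \sum_n 1 * round_noise x (g, b) n = \sum_n round_noise x (g, b) n.
    by apply: eq_bigr => n _; rewrite mul1r.
  rewrite next_stateE !big_split /= -!mulr_sumr sum_mulv_laplacian //.
  ring.
rewrite (eq_bigr (fun b => round_weight x b * (\sum_n x n) ^+ 2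
  + ((2 * al * \sum_n x n) * (round_weight x b * \sum_n 1 * round_noise x (g, b) n)
  + al ^+ 2 * (round_weight x b * (\sum_n 1 * round_noise x (g, b) n) ^+ 2)))); last first.
  by move=> b _; rewrite E; ring.
rewrite !big_split /= -mulr_suml -!mulr_sumr sum_round_weight mul1r.
rewrite (mean_round_noise x g (fun=> 1)) mulr0 add0r lerD2l.
apply: ler_wpM2l; first exact: sqr_ge0.
apply: (le_trans (variance_round_noise x g (fun=> 1))).
by rewrite /edge_count; under eq_bigr do rewrite expr1n mul1r.
Qed.

(** The term linear in the noise averages out, and both second-order terms are bounded through [lN].
    As constants lie in the kernel of the Laplacian, only the centered part of [x] enters, which
    [l2] can later compare with [quad M x]. *)
Lemma quad_next (M : 'M[R]_N) (lN : R) al x g :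
  (forall i j, M i j = M j i) -> (forall y, quad M y <= lN * \sum_n y n ^+ 2) ->
  0 <= lN ->
  \sum_b round_weight x b * quad M (next_state al x (g, b)) <=
  quad M x - 2 * al * bil (laplacian R g) (mulv M x) x
  + al ^+ 2 * (lN * (4 * N%:R ^+ 2 * \sum_n centered x n ^+ 2))
  + al ^+ 2 * (lN * (D ^+ 2 / 3 * edge_count g)).
Proof.
move=> Ms MlN lN0; set L := laplacian R g.
set z := fun n => x n + (- al) * mulv L x n.
rewrite (eq_bigr (fun b => round_weight x b * quad M z
  + ((2 * al) * (round_weight x b * \sum_n mulv M z n * round_noise x (g, b) n)
  + al ^+ 2 * (round_weight x b * quad M (round_noise x (g, b)))))); last first.
  move=> b _; rewrite next_stateE -/z quadD //.
  have -> : bil M (round_noise x (g, b)) z = \sum_n mulv M z n * round_noise x (g, b) n.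
    by apply: eq_bigr => n _; rewrite mulrC.
  ring.
rewrite !big_split /= -mulr_suml -!mulr_sumr sum_round_weight mul1r.
rewrite mean_round_noise mulr0 add0r; apply: lerD; last first.
  apply: ler_wpM2l; first exact: sqr_ge0.
  apply: le_trans (ler_wpM2l lN0 (sqnorm_round_noise x g)).
  rewrite mulr_sumr; apply: ler_sum => b _; rewrite [leRHS]mulrCA.
  by apply: ler_wpM2l; [exact: round_weight_ge0|exact: MlN].
rewrite /z quadD // -!addrA lerD2l sqrrN.
have -> : bil M (mulv L x) x = bil L (mulv M x) x.
  by apply: eq_bigr => n _; rewrite mulrC.
rewrite mulrN mulNr lerD2l; apply: ler_wpM2l; first exact: sqr_ge0.
apply: (le_trans (MlN _)); apply: ler_wpM2l => //.
have <- : mulv L (centered x) = mulv L x by apply: mulv_centered; exact: laplacian_row_sum.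
exact: sqnorm_laplacian_le.
Qed.
End Drift.

(** * Drift of the two potentials after averaging over graphs *)

Section MarkovDrift.
Variables (R : realType) (N : nat) (D : R).
Hypothesis D0 : 0 < D.
Variables (pG : graphT N -> R) (E : nat).
Hypothesis pG_ge0 : forall g, 0 <= pG g.
Hypothesis pG1 : \sum_g pG g = 1.
Hypothesis pGs : forall g, pG g != 0 -> is_simple_graph g.
Hypothesis pGE : \sum_g pG g * edge_count R g <= 2 * E%:R.

Definition step_prob (x : 'I_N -> R) (s : stepT N) : R := pG s.1 * round_weight D x s.2.

Lemma step_prob_ge0 x s : 0 <= step_prob x s.
Proof. by rewrite mulr_ge0 ?round_weight_ge0. Qed.

Lemma sum_step x (F : stepT N -> R) : \sum_s step_prob x s * F s =
  \sum_g pG g * \sum_b round_weight D x b * F (g, b).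
Proof.
rewrite [RHS](eq_bigr (fun g => \sum_b step_prob x (g, b) * F (g, b))); last first.
  by move=> g _; rewrite mulr_sumr; apply: eq_bigr => b _; rewrite mulrA.
by rewrite pair_bigA; apply: eq_bigr => -[g b] _.
Qed.

Lemma sum_step_prob x : \sum_s step_prob x s = 1.
Proof.
have := sum_step x (fun=> 1); under eq_bigr do rewrite mulr1.
move=> ->; rewrite -[RHS]pG1; apply: eq_bigr => g _.
by under eq_bigr do rewrite mulr1; rewrite sum_round_weight mulr1.
Qed.

Lemma sum_pG_le (F G : graphT N -> R) : (forall g, is_simple_graph g -> F g <= G g) ->
  \sum_g pG g * F g <= \sum_g pG g * G g.
Proof.
move=> FG; apply: ler_sum => g _; have [->|pg0] := eqVneq (pG g) 0.
  by rewrite !mul0r.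
by apply: ler_wpM2l => //; apply: FG; exact: pGs.
Qed.

Lemma drift_avg al x : \sum_s step_prob x s * avg (next_state D al x s) ^+ 2 <=
  avg x ^+ 2 + al ^+ 2 * (2 * E%:R * D ^+ 2 / 3 / N%:R ^+ 2).
Proof.
have -> : \sum_s step_prob x s * avg (next_state D al x s) ^+ 2 =
  N%:R ^- 2 * \sum_s step_prob x s * (\sum_n next_state D al x s n) ^+ 2.
  by rewrite mulr_sumr; apply: eq_bigr => s _; rewrite /avg exprMn exprVn; ring.
have -> : avg x ^+ 2 + al ^+ 2 * (2 * E%:R * D ^+ 2 / 3 / N%:R ^+ 2) =
  N%:R ^- 2 * ((\sum_n x n) ^+ 2 + al ^+ 2 * (D ^+ 2 / 3 * (2 * E%:R))).
  by rewrite /avg exprMn exprVn; ring.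
apply: ler_wpM2l; first by rewrite invr_ge0 exprn_ge0.
rewrite sum_step.
apply: (le_trans (sum_pG_le (fun g sg => sum_next_sqr D0 al x sg))).
rewrite (eq_bigr (fun g => pG g * (\sum_n x n) ^+ 2
  + al ^+ 2 * (D ^+ 2 / 3) * (pG g * edge_count R g))); last by move=> g _; ring.
rewrite big_split /= -mulr_suml -mulr_sumr pG1 mul1r lerD2l [leRHS]mulrA.
by apply: ler_wpM2l => //; rewrite mulr_ge0 ?sqr_ge0 // divr_ge0 ?sqr_ge0.
Qed.

(** As [M] is the mean Laplacian, the first-order term averages to -2 [al] times the squared norm of
    [M x] and is dropped. With [mx] the maximum, the Laplacian then adds at most
    [al ^+ 2 * mx * quad M x] and the noise at most [al ^+ 2 * mx]. *)
Lemma drift_quad (M : 'M[R]_N) (l2 lN : R) al x :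
  (forall i j, M i j = \sum_g pG g * laplacian R g i j) ->
  (forall y, quad M y <= lN * \sum_n y n ^+ 2) ->
  (forall y, l2 * \sum_n centered y n ^+ 2 <= quad M y) ->
  0 < l2 -> 0 <= lN -> 0 <= al ->
  \sum_s step_prob x s * (1 + quad M (next_state D al x s)) <=
  (1 + quad M x) * (1 + al ^+ 2 * Num.max (lN ^+ 3 / l2 + 4 * (N%:R) ^+ 2 * lN / l2)
                         (2 * E%:R * D ^+ 2 * lN / 3)).
Proof.
move=> ME MlN Ml2 l20 lN0 al0.
have Ms i j : M i j = M j i.
  rewrite !ME; apply: eq_bigr => g _; have [->|pg0] := eqVneq (pG g) 0.
    by rewrite !mul0r.
  by congr (_ * _); apply: laplacian_sym; exact: pGs.
set mx := Num.max _ _.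
have mx1 : 4 * (N%:R) ^+ 2 * lN / l2 <= mx.
  rewrite /mx le_max lerDr divr_ge0 ?exprn_ge0 //.
  exact: ltW.
have mx2 : 2 * E%:R * D ^+ 2 * lN / 3 <= mx by rewrite /mx le_max lexx orbT.
have q0 : 0 <= quad M x.
  apply: le_trans (Ml2 x); apply: mulr_ge0; first exact: ltW.
  by apply: sumr_ge0 => n _; exact: sqr_ge0.
under eq_bigr do rewrite mulrDr mulr1.
rewrite big_split /= sum_step_prob sum_step.
have step1 : \sum_g pG g * (\sum_b round_weight D x b * quad M (next_state D al x (g, b))) <=
  quad M x - 2 * al * \sum_n mulv M x n ^+ 2
  + al ^+ 2 * (lN * (4 * N%:R ^+ 2 * \sum_n centered x n ^+ 2))
  + al ^+ 2 * (lN * (D ^+ 2 / 3 * (2 * E%:R))).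
  apply: (le_trans (sum_pG_le (fun g sg => quad_next D0 al x g Ms MlN lN0))).
  set K := _ * (lN * (4 * _ * _)).
  rewrite (eq_bigr (fun g => pG g * (quad M x + K)
   + ((- (2 * al)) * (pG g * bil (laplacian R g) (mulv M x) x)
     + al ^+ 2 * (lN * (D ^+ 2 / 3)) * (pG g * edge_count R g)))); last first.
    by move=> g _; ring.
  rewrite !big_split /= -mulr_suml -!mulr_sumr pG1 mul1r.
  have -> : \sum_g pG g * bil (laplacian R g) (mulv M x) x = \sum_n mulv M x n ^+ 2.
    rewrite /bil; under eq_bigr do rewrite mulr_sumr.
    rewrite exchange_big; apply: eq_bigr => n _ /=.
    under eq_bigr do rewrite mulrCA.
    rewrite -mulr_sumr expr2; congr (_ * _); rewrite /mulv.
    under eq_bigr do rewrite mulr_sumr.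
    rewrite exchange_big; apply: eq_bigr => l _ /=.
    by rewrite ME mulr_suml; apply: eq_bigr => g _; rewrite mulrA.
  have c0 : 0 <= al ^+ 2 * (lN * (D ^+ 2 / 3)).
    have := sqr_ge0 D; have := sqr_ge0 al => h1 h2; do !apply: mulr_ge0 => //; lra.
  have := ler_wpM2l c0 pGE; lra.
have mm : 0 <= \sum_n mulv M x n ^+ 2 by apply: sumr_ge0 => n _; exact: sqr_ge0.
have almm := mulr_ge0 al0 mm.
have cq : lN * (4 * N%:R ^+ 2 * \sum_n centered x n ^+ 2) <= mx * quad M x.
  apply: le_trans (ler_wpM2r q0 mx1).
  rewrite [leRHS](_ : _ = 4 * N%:R ^+ 2 * lN * (quad M x / l2)); last by ring.
  rewrite [leLHS](_ : _ = 4 * N%:R ^+ 2 * lN * \sum_n centered x n ^+ 2); last by ring.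
  apply: ler_wpM2l; first by rewrite !mulr_ge0 ?exprn_ge0.
  by rewrite ler_pdivlMr // mulrC.
have a2 := sqr_ge0 al.
have h1 := ler_wpM2l a2 cq; have h2 := ler_wpM2l a2 mx2.
lra.
Qed.
End MarkovDrift.

Lemma measure_bigsetU_le (d : measure_display) (T : measurableType d) (R : realType)
  (mu : {measure set T -> \bar R}) (I : Type) (r : seq I) (F : I -> set T) :
  (forall i, measurable (F i)) ->
  (mu (\big[setU/set0]_(i <- r) F i) <= \sum_(i <- r) mu (F i))%E.
Proof.
move=> mF; elim: r => [|i r IH]; first by rewrite !big_nil measure0.
rewrite !big_cons; apply: (le_trans (measureU2 _ _ _)) => //.
  by apply: bigsetU_measurable => j _.
by rewrite leeD2l.
Qed.

Lemma prod_EFin (R : realType) (I : Type) (r : seq I) (f : I -> R) :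
  (\prod_(i <- r) (f i)%:E = (\prod_(i <- r) f i)%:E)%E.
Proof. by elim: r => [|i r IH]; rewrite ?big_nil // !big_cons IH EFinM. Qed.

(** * The law of a dithered sample *)

Section Quantizer.
Variables (R : realType) (D : R).
Hypothesis D0 : 0 < D.

Lemma measurable_quant : measurable_fun setT (quant D).
Proof.
apply: nondecreasing_measurable => // x y xy.
rewrite /quant ler_pM2r // ler_int le_floor // lerD2r ler_pM2r //.
by rewrite invr_gt0.
Qed.

(** The dither for which [y] plus the dither is the midpoint between the two neighbouring multiples
    of [D]. *)
Definition round_threshold (y : R) : R := D / 2 - D * cell_frac D y.

(** Half-open on the right like the cells of the quantizer, so that the two cells partition the
    dither range without exceptional points. *)
Definition dither_cell (y : R) (c : bool) : set R :=
  [set` if c then `[round_threshold y, D / 2[%R else `[- (D / 2), round_threshold y[%R].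

Lemma measurable_dither_cell y c : measurable (dither_cell y c).
Proof. by case: c; exact: measurable_itv. Qed.

Lemma dither_cell_subset y c :
  dither_cell y c `<=` [set v : R | (- (D / 2) <= v < D / 2)%R].
Proof.
have /andP[f0 f1] := cell_frac_itv D y; move=> v.
by case: c; rewrite /dither_cell /= in_itv /= /round_threshold => /andP[h1 h2];
  apply/andP; split => //; nra.
Qed.

Lemma dither_cell_cover y v : (- (D / 2) <= v < D / 2)%R ->
  dither_cell y (round_threshold y <= v) v.
Proof.
move=> /andP[h1 h2]; case: leP => h; rewrite /dither_cell /= in_itv /=.
  by rewrite h h2.
by rewrite h h1.
Qed.

Lemma quant_dither y c v : dither_cell y c v -> quant D (y + v) = round_to D y c.
Proof.
have /andP[f0 f1] := cell_frac_itv D y.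
move=> cv; rewrite /quant /round_to; congr (_ * D).
have -> : (Num.floor (y / D))%:~R + (c : nat)%:R = (Num.floor (y / D) + (c : nat)%:Z)%:~R :> R.
  by rewrite intrD.
congr (_%:~R); apply/eqP; rewrite floor_eq !intrD /=.
have -> : ((c : nat)%:Z)%:~R = (c : nat)%:R :> R by [].
have fE : (Num.floor (y / D))%:~R = y / D - cell_frac D y by rewrite /cell_frac; ring.
rewrite fE.
have -> : (y + v) / D + 2^-1 = y / D + (v / D + 2^-1) by rewrite mulrDl addrA.
have vE : v = v / D * D by rewrite divfK // gt_eqF.
move: cv; rewrite {1}vE; set u := v / D; rewrite /dither_cell /round_threshold.
move: f0 f1; set f := cell_frac D y => f0 f1.
case: c; rewrite /= in_itv /= => /andP[h1 h2].
  have g1 : 2^-1 - f <= u by rewrite -(ler_pM2r D0); lra.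
  have g2 : u < 2^-1 by rewrite -(ltr_pM2r D0); lra.
  by apply/andP; split; lra.
have g1 : - 2^-1 <= u by rewrite -(ler_pM2r D0); lra.
have g2 : u < 2^-1 - f by rewrite -(ltr_pM2r D0); lra.
by apply/andP; split; lra.
Qed.

Lemma lebesgue_dither_cell y c :
  (lebesgue_measure (dither_cell y c) * (D^-1)%:E = (round_prob D y c)%:E)%E.
Proof.
have /andP[f0 f1] := cell_frac_itv D y.
have Dn : D != 0 by rewrite gt_eqF.
(* The measure formula branches on whether the interval is empty: the upper cell is empty only when
   the fraction is zero, and the lower one never is, the fraction being below 1. *)
case: c; rewrite /dither_cell /= lebesgue_measure_itv /= lte_fin /round_threshold;
  case: ltP => h; rewrite -?EFinD -?EFinM ?mul0e.
- by congr (_%:E); rewrite /round_prob; field.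
- by rewrite mul0r; congr (_%:E); apply/eqP; rewrite eq_le f0 /= -(ler_pM2l D0); lra.
- by congr (_%:E); rewrite /round_prob; field.
- exfalso; have f2 : 0 < 1 - cell_frac D y; [lra|have := mulr_gt0 D0 f2; lra].
Qed.
End Quantizer.

(** * Finite paths and their probabilities *)

Section Paths.
Context (R : realType) (d : measure_display) (T : measurableType d).
Variables (P : probability T R) (N : nat) (D : R) (alpha : nat -> R).
Variables (A : nat -> T -> graphT N) (nu : nat -> 'I_N -> 'I_N -> T -> R).
Variable x0 : 'I_N -> R.
Hypothesis D0 : 0 < D.
Hypothesis mA : forall i (S : set (graphT N)), measurable (A i @^-1` S).
Hypothesis idA : forall i (S : set (graphT N)), P (A i @^-1` S) = P (A 0%N @^-1` S).
Hypothesis mnu : forall i n l, measurable_fun setT (nu i n l).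
Hypothesis unu : forall i n l (B : set R), measurable B ->
     P (nu i n l @^-1` B) =
     (lebesgue_measure (B `&` [set y : R | (- (D / 2) <= y < D / 2)%R]) * (D^-1)%:E)%E.
Hypothesis indep : mutually_independent P (qc_events A nu).

Definition graph_prob (g : graphT N) : R := fine (P (A 0%N @^-1` [set g])).

Lemma graph_probE i g : P (A i @^-1` [set g]) = (graph_prob g)%:E.
Proof. by rewrite idA /graph_prob fineK // fin_num_measure. Qed.

Lemma graph_prob_ge0 g : 0 <= graph_prob g.
Proof. exact: fine_ge0. Qed.

Lemma measurable_nu i n l (B : set R) : measurable B -> measurable (nu i n l @^-1` B).
Proof. by move=> mB; rewrite -[X in measurable X]setTI; exact: mnu. Qed.

Lemma prob_dither_cell i n l y c : P (nu i n l @^-1` dither_cell D y c) = (round_prob D y c)%:E.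
Proof.
rewrite unu; last exact: measurable_dither_cell.
rewrite setIidl; last exact: dither_cell_subset.
exact: lebesgue_dither_cell.
Qed.

Let index := (nat + (nat * 'I_N * 'I_N))%type.

Definition index_time (k : index) : nat :=
  match k with inl i => i | inr (i, _, _) => i end.

Definition indices_at (i : nat) : seq index :=
  inl i :: [seq inr (i, e.1, e.2) | e <- enum [the finType of ('I_N * 'I_N)%type]].

Fixpoint indices_before (i : nat) : seq index :=
  if i is i'.+1 then indices_at i' ++ indices_before i' else [::].

Lemma indices_beforeS i : indices_before i.+1 = indices_at i ++ indices_before i.
Proof. by []. Qed.

Lemma indices_at_time i k : k \in indices_at i -> index_time k = i.
Proof. by rewrite inE => /orP[/eqP ->|/mapP[e _ ->]]. Qed.

Lemma indices_before_time i k : k \in indices_before i -> (index_time k < i)%N.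
Proof.
elim: i => // i IH; rewrite indices_beforeS mem_cat => /orP[/indices_at_time -> //|/IH].
exact: ltnW.
Qed.

Lemma indices_before_uniq i : uniq (indices_before i).
Proof.
elim: i => // i IH; rewrite indices_beforeS cat_uniq IH andbT.
apply/andP; split.
  rewrite /= map_inj_uniq ?enum_uniq ?andbT.
    by apply/negP => /mapP[].
  by move=> [a b] [a' b'] [-> ->].
by apply/hasPn => k /indices_before_time ki; apply/negP => /indices_at_time ik;
  rewrite ik ltnn in ki.
Qed.

(** One event per graph or dither variable, so that a transition is an intersection to which [indep]
    applies. *)
Definition step_event (i : nat) (x : 'I_N -> R) (s : stepT N) (k : index) : set T :=
  match k with
  | inl _ => A i @^-1` [set s.1]
  | inr (_, n, l) => nu i n l @^-1` dither_cell D (x l) (s.2 (n, l))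
  end.

Lemma step_event_prob i x s :
  (\prod_(k <- indices_at i) P (step_event i x s k) =
   (step_prob D graph_prob x s)%:E)%E.
Proof.
rewrite /indices_at big_cons big_map graph_probE.
rewrite (eq_bigr (fun e => (round_prob D (x e.2) (s.2 e))%:E)); last first.
  by case=> n l _ /=; rewrite prob_dither_cell.
by rewrite prod_EFin -EFinM /step_prob /round_weight big_enum.
Qed.

(* Histories list the steps newest first. *)
Fixpoint path_state (p : seq (stepT N)) : 'I_N -> R :=
  if p is s :: p' then next_state D (alpha (size p')) (path_state p') s else x0.

Definition step_set i x s : set T := \big[setI/setT]_(k <- indices_at i) step_event i x s k.

Fixpoint path_set (p : seq (stepT N)) : set T :=
  if p is s :: p' then step_set (size p') (path_state p') s `&` path_set p' else setT.

Lemma path_setS s p :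
  path_set (s :: p) = step_set (size p) (path_state p) s `&` path_set p.
Proof. by []. Qed.

Definition extend_family (E : index -> set T) i x s (k : index) : set T :=
  if index_time k == i then step_event i x s k else E k.

Lemma extend_family_new E i x s k :
  k \in indices_at i -> extend_family E i x s k = step_event i x s k.
Proof. by move=> /indices_at_time kt; rewrite /extend_family kt eqxx. Qed.

Lemma extend_family_old E i x s k :
  k \in indices_before i -> extend_family E i x s k = E k.
Proof. by move=> /indices_before_time kt; rewrite /extend_family ltn_eqF. Qed.

Lemma extend_family_events E i x s :
  (forall k, k \in indices_before i -> qc_events A nu k (E k)) ->
  forall k, k \in indices_before i.+1 -> qc_events A nu k (extend_family E i x s k).
Proof.
move=> FE k; rewrite indices_beforeS mem_cat => /orP[kp|kp]; last first.
  by rewrite extend_family_old //; exact: FE.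
rewrite extend_family_new //; have := indices_at_time kp.
case: k kp => [j _ /= ->|[[j n] l] _ /= ->]; first by exists [set s.1].
exists (dither_cell D (x l) (s.2 (n, l))); split => //.
exact: measurable_dither_cell.
Qed.

(** Presents a path as a single intersection over distinct indices, the form in which mutual
    independence is stated. *)
Lemma path_set_family p : exists E : index -> set T,
  (forall k, k \in indices_before (size p) -> qc_events A nu k (E k)) /\
  path_set p = \big[setI/setT]_(k <- indices_before (size p)) E k.
Proof.
elim: p => [|s p [E [FE pE]]]; first by exists (fun=> setT); rewrite big_nil.
exists (extend_family E (size p) (path_state p) s); split.
  exact: extend_family_events.
rewrite indices_beforeS big_cat path_setS pE.
congr (_ `&` _); rewrite /step_set !big_seq; apply: eq_bigr => k kp.
  by rewrite extend_family_new.
by rewrite extend_family_old.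
Qed.

(** Markov property: independence is used for the longer and for the shorter path, and the factors
    of the new indices multiply to the transition weight, which sees the past only through
    [path_state p]. *)
Lemma path_set_cons_prob s p :
  (P (path_set (s :: p)) = P (path_set p) * (step_prob D graph_prob (path_state p) s)%:E)%E.
Proof.
have [E [FE pE]] := path_set_family p.
have FE' := @extend_family_events E (size p) (path_state p) s FE.
have -> : path_set (s :: p) = \big[setI/setT]_(k <- indices_before (size p).+1)
    extend_family E (size p) (path_state p) s k.
  rewrite indices_beforeS big_cat path_setS pE.
  congr (_ `&` _); rewrite /step_set !big_seq; apply: eq_bigr => k kp.
    by rewrite extend_family_new.
  by rewrite extend_family_old.
rewrite (indep (indices_before_uniq _) FE') pE (indep (indices_before_uniq _) FE).
rewrite indices_beforeS big_cat [RHS]muleC -(step_event_prob (size p)).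
rewrite !big_seq; congr (_ * _)%E; apply: eq_bigr => k kp.
  by rewrite extend_family_new.
by rewrite extend_family_old.
Qed.

Lemma measurable_step_set i x s : measurable (step_set i x s).
Proof.
rewrite /step_set; elim: (indices_at i) => [|k r IH]; first by rewrite big_nil.
rewrite big_cons; apply: measurableI => //.
case: k => [j|[[j n] l]] /=; first exact: mA.
by apply: measurable_nu; exact: measurable_dither_cell.
Qed.

Lemma measurable_path_set p : measurable (path_set p).
Proof.
elim: p => [|s p IH]; first exact: measurableT.
by apply: measurableI => //; exact: measurable_step_set.
Qed.

Lemma step_setP i x s w : step_set i x s w ->
  A i w = s.1 /\ forall n l, dither_cell D (x l) (s.2 (n, l)) (nu i n l w).
Proof.
rewrite /step_set; rewrite -bigcap_seq => H; split.
  by have := H (inl i); apply; rewrite /= inE eqxx.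
move=> n l; have := H (inr (i, n, l)); apply => /=.
by rewrite inE; apply/orP; right; apply/mapP; exists (n, l); rewrite ?mem_enum.
Qed.

Lemma path_set_state p w : path_set p w ->
  qc_state D alpha A nu x0 (size p) w = path_state p.
Proof.
elim: p => // s p IH /= [/step_setP[As nus] /IH ->].
apply/funext => n; rewrite /next_state As; congr (_ + _ * _).
by apply: eq_bigr => l _; exact: quant_dither.
Qed.

Definition dither_in_range (w : T) : Prop :=
  forall i n l, (- (D / 2) <= nu i n l w < D / 2)%R.

Lemma step_set_cover i x w : dither_in_range w -> exists s, step_set i x s w.
Proof.
(* The observed graph, rounding up exactly where the dither has reached its threshold. *)
move=> rw; exists (A i w, [ffun e : 'I_N * 'I_N => round_threshold D (x e.2) <= nu i e.1 e.2 w]).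
rewrite /step_set -bigcap_seq; case=> [j|[[j n] l]] _ //=.
by rewrite ffunE; exact: dither_cell_cover.
Qed.

(** The triples of indices are countable, so the null sets of out-of-range dithers are united along
    their encoding by [pickle]. *)
Lemma dither_in_range_ae : exists Z : set T,
  [/\ measurable Z, P Z = 0%E & forall w, ~ Z w -> dither_in_range w].
Proof.
pose bad (k : nat) : set T :=
  if @unpickle [the countType of (nat * 'I_N * 'I_N)%type] k is Some e
  then nu e.1.1 e.1.2 e.2 @^-1` (~` `[- (D / 2), D / 2[) else set0.
have mC : measurable (~` [set` `[- (D / 2), D / 2[] : set R).
  by apply: measurableC; exact: measurable_itv.
have mbad k : measurable (bad k).
  by rewrite /bad; case: unpickle => [e|//]; exact: measurable_nu.
have Pbad k : P (bad k) = 0%E.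
  rewrite /bad; case: unpickle => [e|]; last exact: measure0.
  rewrite unu // (_ : _ `&` _ = set0) ?measure0 ?mul0e //.
  apply/seteqP; split=> // v /= [nv hv]; apply: nv.
  by rewrite /= in_itv.
exists (\bigcup_k bad k); split; first exact: bigcupT_measurable.
  apply: measure_negligible; first exact: bigcupT_measurable.
  by apply: negligible_bigcup => k; exists (bad k); split => //; exact: Pbad.
move=> w Zw i n l; apply: contrapT => h; apply: Zw.
exists (pickle (i, n, l)) => //; rewrite /bad pickleK /= => hw; apply: h.
by move: hw; rewrite in_itv.
Qed.

Lemma measurable_graph_fun (h : graphT N -> R) i : measurable_fun setT (fun w => h (A i w)).
Proof. by move=> _ B mB; rewrite setTI; exact: (mA i (h @^-1` B)). Qed.

Lemma measurable_qc_state i n :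
  measurable_fun setT (fun w => qc_state D alpha A nu x0 i w n).
Proof.
elim: i n => [|i IH] n /=; first exact: measurable_cst.
apply: measurable_funD.
  apply: measurable_funM => //.
  exact: (measurable_graph_fun (fun g => 1 - alpha i * (degree g n)%:R)).
apply: measurable_funM; first exact: measurable_cst.
rewrite (_ : (fun w => _) = fun w => \sum_(l < N) (A i w (n, l))%:R *
   quant D (qc_state D alpha A nu x0 i w l + nu i n l w)); last first.
  apply/funext => w; rewrite [LHS]big_mkcond; apply: eq_bigr => l _.
  by case: (A i w _); rewrite ?mul1r ?mul0r.
apply: measurable_sum => l; apply: measurable_funM.
  exact: (measurable_graph_fun (fun g => (g (n, l))%:R)).
apply: (measurableT_comp (measurable_quant D0)).
exact: measurable_funD.
Qed.

(** * Maximal inequality for a nonnegative supermartingale potential [V] *)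

Section MaximalInequality.
Variables (phi : ('I_N -> R) -> bool) (V : nat -> ('I_N -> R) -> R).
Hypothesis mphi : forall i, measurable [set w | phi (qc_state D alpha A nu x0 i w)].
Hypothesis V_ge0 : forall i x, 0 <= V i x.
Hypothesis V_ge1 : forall i x, phi x -> 1 <= V i x.
Hypothesis V_drift : forall i x,
  \sum_s step_prob D graph_prob x s * V i.+1 (next_state D (alpha i) x s) <= V i x.

(** The recursion splits off the earliest time, in step with the extension of a path by one
    transition. *)
Fixpoint hit (i n : nat) : set T :=
  [set w | phi (qc_state D alpha A nu x0 i w)] `|` (if n is n'.+1 then hit i.+1 n' else set0).

Lemma measurable_hit i n : measurable (hit i n).
Proof.
by elim: n i => [|n IH] i /=; apply: measurableU => //; exact: mphi.
Qed.

Lemma hitP i n w : hit i n w <->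
  exists2 j, (i <= j <= i + n)%N & phi (qc_state D alpha A nu x0 j w).
Proof.
elim: n i => [|n IH] i /=; split.
- by case=> // h; exists i => //; rewrite addn0 leqnn.
- by case=> j; rewrite addn0 -eqn_leq => /eqP -> h; left.
- case=> [h|/IH[j /andP[h1 h2] h]]; first by exists i => //; rewrite leqnn leq_addr.
  by exists j => //; rewrite (ltnW h1) addnS -addSn h2.
- case=> j /andP[]; rewrite leq_eqVlt => /orP[/eqP <- _|h1 h2] h; first by left.
  by right; apply/IH; exists j => //; rewrite h1 addSn -addnS.
Qed.

(** Induction on the horizon, for all paths at once. If [phi] fails at the end of the path, a hit
    comes later and the event is covered by the one-step extensions, whose bounds sum to at most the
    claim by [V_drift]. Outside [Z] such an extension always exists. *)
Lemma path_hit_le Z : measurable Z -> (forall w, ~ Z w -> dither_in_range w) ->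
  forall n p, (P (path_set p `&` hit (size p) n `&` ~` Z) <=
    P (path_set p) * (V (size p) (path_state p))%:E)%E.
Proof.
move=> mZ Zr; have mZc := measurableC mZ.
have mph p n : measurable (path_set p `&` hit (size p) n `&` ~` Z).
  apply: measurableI => //; apply: measurableI; [exact: measurable_path_set|exact: measurable_hit].
elim=> [|n IH] p; have [ph|nph] := boolP (phi (path_state p)).
(* For either form of the horizon, [phi] already holds at the end of the path, where [V] is at least
   1. *)
1,3: apply: (@le_trans _ _ (P (path_set p))); [
  apply: le_measure; rewrite ?inE //; [exact: measurable_path_set|by move=> w [[]]] |
  by rewrite -[leLHS]mule1 lee_wpmul2l // lee_fin V_ge1 ].
  rewrite (_ : _ `&` _ = set0) ?measure0 ?mule_ge0 // ?lee_fin //.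
  apply/seteqP; split=> // w [[/path_set_state pw /=]].
  by rewrite pw (negbTE nph) => -[].
apply: (@le_trans _ _ (P (\big[setU/set0]_(s : stepT N)
    (path_set (s :: p) `&` hit (size (s :: p)) n `&` ~` Z)))).
  apply: le_measure; rewrite ?inE //; first by apply: bigsetU_measurable => s _.
  move=> w [[pw hw] zw]; rewrite -bigcup_seq.
  have [s sw] := step_set_cover (size p) (path_state p) (Zr _ zw).
  exists s; first by rewrite /= mem_index_enum.
  split=> //; split; first by split.
  by case: hw => //=; rewrite (path_set_state pw) (negbTE nph).
apply: (le_trans (measure_bigsetU_le P _ (fun s => mph (s :: p) n))).
apply: (@le_trans _ _ (\sum_(s : stepT N) P (path_set p) *
   (step_prob D graph_prob (path_state p) s * V (size p).+1
     (next_state D (alpha (size p)) (path_state p) s))%:E)%E).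
  apply: lee_sum => s _; apply: (le_trans (IH (s :: p))).
  by rewrite path_set_cons_prob -muleA -EFinM lexx.
rewrite -ge0_sume_distrr; last first.
  by move=> s _; rewrite lee_fin mulr_ge0 //; apply: step_prob_ge0 => //; exact: graph_prob_ge0.
by rewrite lee_wpmul2l // sumEFin lee_fin.
Qed.

(** The previous bound is applied to the empty path, whose event is the whole space, and the horizon
    tends to infinity by continuity from below. *)
Lemma maximal_inequality :
  (P (\bigcup_n [set w | phi (qc_state D alpha A nu x0 n w)]) <= (V 0 x0)%:E)%E.
Proof.
have [Z [mZ PZ Zr]] := dither_in_range_ae.
have hn n : (P (hit 0 n) <= (V 0 x0)%:E)%E.
  apply: (@le_trans _ _ (P (hit 0 n `&` ~` Z) + P Z)%E).
    apply: (@le_trans _ _ (P ((hit 0 n `&` ~` Z) `|` Z))).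
      apply: le_measure; rewrite ?inE; [exact: measurable_hit| |].
        by apply: measurableU => //; apply: measurableI; [exact: measurable_hit|exact: measurableC].
      by move=> w hw; have [zw|zw] := pselect (Z w); [right|left].
    apply: measureU2 => //; apply: measurableI; [exact: measurable_hit|exact: measurableC].
  rewrite PZ adde0.
  have := path_hit_le mZ Zr n [::]; rewrite /= setTI.
  by rewrite probability_setT mul1e.
have -> : \bigcup_n [set w | phi (qc_state D alpha A nu x0 n w)] = \bigcup_n hit 0 n.
  apply/seteqP; split=> w [n _ h]; first by exists n => //; apply/hitP; exists n => //=; rewrite add0n.
  by have [j _ hj] := (hitP _ _ _).1 h; exists j.
have cv : (P \o hit 0) x @[x --> \oo] --> P (\bigcup_n hit 0 n).
  apply: nondecreasing_cvg_mu => [i||i j ij]; first exact: measurable_hit.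
    by apply: bigcupT_measurable => i; exact: measurable_hit.
  apply/subsetPset => w /hitP[k /andP[_ hk] h]; apply/hitP; exists k => //=.
  exact: leq_trans ij.
rewrite -(cvg_lim _ cv) //; apply: lime_le; first by apply/cvg_ex; eexists; exact: cv.
by apply: nearW => n; exact: hn.
Qed.
End MaximalInequality.
End Paths.

(** * The law of the random graph and its mean Laplacian *)

Section GraphLaw.
Context (R : realType) (d : measure_display) (T : measurableType d).
Variables (P : probability T R) (N : nat) (A : nat -> T -> graphT N).
Hypothesis mA : forall i (S : set (graphT N)), measurable (A i @^-1` S).
Hypothesis sA : forall i w, is_simple_graph (A i w).

Lemma expectation_graph (h : graphT N -> R) :
  ('E_P[fun w => h (A 0%N w)] = (\sum_g graph_prob P A g * h g)%:E)%E.
Proof.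
rewrite unlock.
under eq_integral => w _.
  rewrite (_ : (h (A 0 w))%:E = \sum_g (h g)%:E * (\1_(A 0%N @^-1` [set g]) w)%:E)%E; last first.
    rewrite (bigD1 (A 0%N w)) //= [X in (_ + X)%E]big1 => [|g gA].
      by rewrite indicE mem_set // mule1 adde0.
    rewrite indicE memNset ?mule0 //= => e; by rewrite e eqxx in gA.
  over.
have mg g : measurable (A 0%N @^-1` [set g]) by exact: mA.
have ig g : P.-integrable setT (fun w => (\1_(A 0%N @^-1` [set g]) w)%:E).
  by apply: integrable_indic; exact: mA.
rewrite integral_sum //; last by move=> g; exact: integrableZl.
rewrite -sumEFin; apply: eq_bigr => g _.
rewrite integralZl // integral_indic //.
by rewrite setIT EFinM muleC /graph_prob fineK // fin_num_measure.
Qed.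

Lemma sum_graph_prob : \sum_g graph_prob P A g = 1.
Proof.
have := expectation_graph (fun=> 1); rewrite expectation_cst => -[->].
by apply: eq_bigr => g _; rewrite mulr1.
Qed.

Lemma LbarE i j : Lbar P A i j = \sum_g graph_prob P A g * laplacian R g i j.
Proof. by rewrite mxE (expectation_graph (fun g => laplacian R g i j)). Qed.

Lemma graph_prob_simple g : graph_prob P A g != 0 -> is_simple_graph g.
Proof.
move=> g0; have [[w Aw]|nw] := pselect (exists w, A 0%N w = g).
  by rewrite -Aw; exact: sA.
move: g0; rewrite /graph_prob (_ : _ @^-1` _ = set0) ?measure0 ?eqxx //.
by apply/seteqP; split=> // w Aw; apply: nw; exists w.
Qed.

(** A graph of positive probability has only realizable edges, and each of its ordered pairs lies in
    [M] either itself or after swapping; the two indicators sum to twice the cardinality of [M]. *)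
Lemma mean_edge_count :
  \sum_g graph_prob P A g * edge_count R g <= 2 * (n_realizable P A)%:R.
Proof.
rewrite -[leRHS]mul1r -[X in _ <= X * _]sum_graph_prob mulr_suml; apply: ler_sum => g _.
have [->|g0] := eqVneq (graph_prob P A g) 0; first by rewrite !mul0r.
apply: ler_wpM2l; first exact: graph_prob_ge0.
have sg := graph_prob_simple g0.
set M := [set e : 'I_N * 'I_N | (e.1 < e.2)%N && (0 < P (A 0%N @^-1` [set g : graphT N | g e]))%E].
have gM e : g e -> (e.1 < e.2)%N -> e \in M.
  move=> ge e12; rewrite inE /M /= e12 /=.
  apply: (@lt_le_trans _ _ (P (A 0%N @^-1` [set g]))).
    rewrite -(fineK (fin_num_measure P _ (mA 0%N [set g]))) lte_fin lt_def g0.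
    exact: graph_prob_ge0.
  by apply: le_measure; rewrite ?inE // => w /= ->.
pose sw (e : 'I_N * 'I_N) := (e.2, e.1).
have cM : #|M|%:R = \sum_e (e \in M)%:R :> R.
  rewrite -sum1_card natr_sum big_mkcond /=; apply: eq_bigr => e _.
  by case: (e \in M).
have -> : 2 * (n_realizable P A)%:R = \sum_e ((e \in M)%:R + (sw e \in M)%:R) :> R.
  rewrite big_split /= mulr_natl mulr2n; congr (_ + _); first exact: cM.
  rewrite [LHS]cM; apply: (reindex sw); exists sw => -[n l] _ //.
apply: ler_sum => -[n l] _; case ge: (g (n, l)); last by rewrite addr_ge0.
have [nl|ln|nl] := ltngtP n l.
- by rewrite (gM _ ge nl) lerDl.
- rewrite (gM (sw (n, l)) _ ln) ?lerDr //= /sw /=.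
  by have [<- _] := sg n l.
- by move: ge; rewrite (ord_inj nl); have [_ ->] := sg l l.
Qed.
End GraphLaw.

(** * Convergence of infinite products *)

Section Products.
Variables (R : realType) (u : nat -> R).
Hypothesis u_ge0 : forall i, 0 <= u i.

Lemma prod_1D_gt0 n : 0 < \prod_(j < n) (1 + u j).
Proof. by apply: prodr_gt0 => j _; rewrite ltr_wpDr. Qed.

Lemma series_le_lim n : cvgn (series u) -> \sum_(j < n) u j <= limn (series u).
Proof.
move=> cu; rewrite -(big_mkord xpredT u).
apply: (nondecreasing_cvgn_le _ cu n).
exact: nondecreasing_series.
Qed.

Lemma nondecreasing_prod_1D : nondecreasing_seq (fun n => \prod_(j < n) (1 + u j)).
Proof.
apply/nondecreasing_seqP => n; rewrite big_ord_recr /=.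
by rewrite ler_peMr ?lerDl // ltW // prod_1D_gt0.
Qed.

(** By 1 + u <= exp u the nondecreasing partial products are bounded by the exponential of the sum
    of the series, so they converge. *)
Lemma prod_1D_le_lim n : cvgn (series u) ->
  \prod_(j < n) (1 + u j) <= limn (fun n => \prod_(j < n) (1 + u j)).
Proof.
move=> cu; apply: (nondecreasing_cvgn_le nondecreasing_prod_1D).
apply: nondecreasing_is_cvgn; first exact: nondecreasing_prod_1D.
exists (expR (limn (series u))) => _ [m _ <-].
apply: (@le_trans _ _ (expR (\sum_(j < m) u j))).
  rewrite expR_sum; apply: ler_prod => j _.
  by rewrite expR_ge1Dx addr_ge0.
by rewrite ler_expR series_le_lim.
Qed.
End Products.

(** * Combination of the two potentials and the final bound *)

Lemma ler_sqrt_ratio (R : realType) (B a : R) : 0 <= B -> 0 < a ->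
  Num.sqrt B / a <= 1 -> B / a ^+ 2 <= Num.sqrt B / a.
Proof.
move=> B0 a0 h.
have -> : B / a ^+ 2 = (Num.sqrt B / a) ^+ 2 by rewrite expr_div_n sqr_sqrtr.
have t0 : 0 <= Num.sqrt B / a by rewrite divr_ge0 ?sqrtr_ge0 ?ltW.
by rewrite expr2 ler_piMr.
Qed.

Theorem mainTheorem10 (R : realType) (d : measure_display) (T : measurableType d)
  (P : probability T R) (N : nat) (D : R) (alpha : nat -> R)
  (A : nat -> T -> graphT N) (nu : nat -> 'I_N -> 'I_N -> T -> R) (lam : seq R) :
  (2 <= N)%N ->
  0 < D ->
  (forall i, 0 < alpha i) ->
  series alpha @ \oo --> +oo ->
  cvgn (series (fun i => alpha i ^+ 2)) ->
  (* random simple undirected graphs, measurable *)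
  (forall i w, is_simple_graph (A i w)) ->
  (forall i (S : set (graphT N)), measurable (A i @^-1` S)) ->
  (* identically distributed graphs *)
  (forall i (S : set (graphT N)), P (A i @^-1` S) = P (A 0%N @^-1` S)) ->
  (* dithers: measurable, uniform on [-D/2, D/2) *)
  (forall i n l, measurable_fun setT (nu i n l)) ->
  (forall i n l (B : set R), measurable B ->
     P (nu i n l @^-1` B) =
     (lebesgue_measure (B `&` [set y : R | (- (D / 2) <= y < D / 2)%R]) * (D^-1)%:E)%E) ->
  (* all graphs and dithers mutually independent *)
  mutually_independent P (qc_events A nu) ->
  (* eigenvalues of Lbar, with lambda_2 > 0 *)
  sorted_spectrum (Lbar P A) lam ->
  0 < lam`_1 ->
  forall (x0 : 'I_N -> R) (a : R), 0 < a ->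
  (P [set w | a%:E < ereal_sup (range (fun j => (vnorm (qc_state D alpha A nu x0 j w))%:E))]
   <= (qc_bound (n_realizable P A) D lam`_1 lam`_N.-1 alpha (Lbar P A) x0 a)%:E)%E.
Proof.
move=> N2 D0 al0 _ cal sA mA idA mnu unu indep spec l10 x0 a a0.
have N0 : (0 < N)%N by exact: leq_trans N2.
have NR : 0 < N%:R :> R by rewrite ltr0n.
set M := Lbar P A; set E := n_realizable P A; set l2 := lam`_1; set lN := lam`_N.-1.
(* Lists are indexed from 0, so [l2] is the second eigenvalue and [lN] the last; [2 <= N] gives
   [1 <= N.-1]. *)
have l2N : l2 <= lN.
  have [sz so _] := spec.
  by apply: (sorted_leq_nth le_trans le_refl 0 so); rewrite ?inE ?sz //;
    case: (N) N2 => [|[|n]].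
have lN0 : 0 <= lN by rewrite (le_trans _ l2N) // ltW.
have pG0 : forall g, 0 <= graph_prob P A g by exact: graph_prob_ge0.
have pG1 := sum_graph_prob P mA.
have pGs := graph_prob_simple sA (P := P).
have ME : forall i j, M i j = \sum_g graph_prob P A g * laplacian R g i j.
  by move=> i j; exact: LbarE.
have Ms i j : M i j = M j i.
  rewrite !ME; apply: eq_bigr => g _; have [->|pg0] := eqVneq (graph_prob P A g) 0.
    by rewrite !mul0r.
  by congr (_ * _); apply: laplacian_sym; exact: pGs.
have M0 n : \sum_l M n l = 0.
  under eq_bigr do rewrite ME.
  by rewrite exchange_big big1 // => g _; rewrite -mulr_sumr laplacian_row_sum mulr0.
have MlN y : quad M y <= lN * \sum_n y n ^+ 2 by exact: quad_le_max_eigenvalue.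
have Ml2 y : l2 * \sum_n centered y n ^+ 2 <= quad M y.
  rewrite -quad_centered //; apply: quad_ge_eigenvalue1 => //.
    by move=> n; rewrite -[RHS](M0 n); apply: eq_bigr => l _.
  exact: sum_centered.
have q0 y : 0 <= quad M y.
  apply: le_trans (Ml2 y); apply: mulr_ge0; first exact: ltW.
  by apply: sumr_ge0 => n _; exact: sqr_ge0.
pose S2 := limn (series (fun j => alpha j ^+ 2)).
have S2n n : \sum_(j < n) alpha j ^+ 2 <= S2.
  by apply: series_le_lim => // j; exact: sqr_ge0.
pose g := qc_g N E D l2 lN alpha.
have g0 j : 0 <= g j.
  rewrite /g /qc_g mulr_ge0 ?sqr_ge0 // le_max; apply/orP; right.
  by rewrite !mulr_ge0 ?invr_ge0 ?(ltW D0).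
have cg : cvgn (series g).
  rewrite /g /qc_g; set mx := Num.max _ _.
  rewrite (_ : series _ = fun n => mx * series (fun j => alpha j ^+ 2) n).
    exact: is_cvgMr.
  by apply/funext => n; rewrite /series /= mulr_sumr; apply: eq_bigr => j _; rewrite mulrC.
pose Pi n := \prod_(j < n) (1 + g j).
pose G := limn Pi.
have PiG n : Pi n <= G by exact: prod_1D_le_lim.
have Pi0 n : 0 < Pi n by exact: prod_1D_gt0.
have G0 : 0 < G := lt_le_trans (Pi0 0%N) (PiG 0%N).
(* The coefficient of [al ^+ 2] in [drift_avg]. *)
pose v := 2 * E%:R * D ^+ 2 / 3 / N%:R ^+ 2.
have v0 : 0 <= v by rewrite /v !mulr_ge0 ?invr_ge0 ?exprn_ge0 ?(ltW D0) ?(ltW a0).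
(* Normalization: [c * avg x ^+ 2] reaches 1 exactly when N avg(x)^2 reaches a^2 / 2. *)
pose c := 2 * N%:R / a ^+ 2.
have c0 : 0 <= c by rewrite /c !mulr_ge0 ?invr_ge0 ?exprn_ge0 ?(ltW D0) ?(ltW a0).
(* By [Ml2], a lower bound for [1 + quad M x] once the centered part has squared norm at least a^2 /
   2. *)
pose C := 1 + a ^+ 2 / 2 * l2.
have C0 : 0 < C by rewrite /C ltr_wpDr // !mulr_ge0 ?invr_ge0 ?exprn_ge0 ?(ltW a0) ?(ltW l10).
(* The quotient [G / Pi i] is the tail product of the factors [1 + g j] for [j >= i], the growth
   still to come. *)
pose K i := G / Pi i / C.
have K0 i : 0 <= K i by rewrite /K !divr_ge0 // ltW.
pose V i x := c * (avg x ^+ 2 + v * (S2 - \sum_(j < i) alpha j ^+ 2)) + (1 + quad M x) * K i.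
pose phi (x : 'I_N -> R) := a < vnorm x.
have V1_ge0 i (x : 'I_N -> R) : 0 <= c * (avg x ^+ 2 + v * (S2 - \sum_(j < i) alpha j ^+ 2)).
  by rewrite mulr_ge0 // addr_ge0 ?sqr_ge0 // mulr_ge0 // subr_ge0.
have V2_ge0 i x : 0 <= (1 + quad M x) * K i by rewrite mulr_ge0 // addr_ge0.
have mphi i : measurable [set w | phi (qc_state D alpha A nu x0 i w)].
  have mv : measurable_fun setT (fun w => vnorm (qc_state D alpha A nu x0 i w)).
    rewrite /vnorm.
    apply: (@measurableT_comp _ _ _ _ _ _ (@Num.sqrt R)).
      by apply: nondecreasing_measurable => // x y; exact: ler_wsqrtr.
    apply: measurable_sum => n; apply: measurable_funX.
    exact: measurable_qc_state.
  have := mv measurableT [set` `]a, +oo[] (measurable_itv _); rewrite setTI.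
  by congr measurable; apply/seteqP; split => w /=; rewrite in_itv /= andbT.
have V_ge1 i x : phi x -> 1 <= V i x.
  rewrite /phi /vnorm => ax.
  have a2 : a ^+ 2 < \sum_n x n ^+ 2.
    have s0 : 0 <= \sum_n x n ^+ 2 by apply: sumr_ge0 => n _; exact: sqr_ge0.
    by rewrite -(sqr_sqrtr s0) ltr_sqr // nnegrE ?sqrtr_ge0 ?ltW.
  rewrite (sqnorm_centered x N0) in a2.
  (* One of the two parts of [x] carries at least half of a^2; its summand of [V] is at least 1 and
     the other is nonnegative. *)
  have [h|h] := lerP (a ^+ 2 / 2) (N%:R * avg x ^+ 2).
    rewrite /V -[leLHS]addr0; apply: lerD => //.
    rewrite /c mulrAC ler_pdivlMr ?exprn_gt0 // mul1r.
    have : 0 <= v * (S2 - \sum_(j < i) alpha j ^+ 2) by rewrite mulr_ge0 // subr_ge0.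
    set z := v * _ => z0.
    have := mulr_ge0 (ltW NR) z0; lra.
  rewrite /V -[leLHS]add0r; apply: lerD => //.
  have hC : C <= 1 + quad M x.
    rewrite /C lerD2l mulrC; apply: le_trans (Ml2 x).
    by apply: ler_wpM2l; [exact: ltW|lra].
  have hG : 1 <= G / Pi i by rewrite ler_pdivlMr // mul1r.
  rewrite /K mulrCA -[leLHS]mul1r; apply: ler_pM => //.
  by rewrite ler_pdivlMr // mul1r.
have V_drift i x : \sum_s step_prob D (graph_prob P A) x s *
    V i.+1 (next_state D (alpha i) x s) <= V i x.
  rewrite /V big_ord_recr /=.
  set Si := \sum_(j < i) _.
  rewrite (eq_bigr (fun s => c * (step_prob D (graph_prob P A) x s * avg (next_state D (alpha i) x s) ^+ 2)
    + (step_prob D (graph_prob P A) x s * (c * (v * (S2 - (Si + alpha i ^+ 2))))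
    + (step_prob D (graph_prob P A) x s * (1 + quad M (next_state D (alpha i) x s))) * K i.+1))); last first.
    by move=> s _; ring.
  rewrite !big_split /= -mulr_sumr -!mulr_suml (sum_step_prob D pG1) mul1r.
  rewrite addrA; apply: lerD.
    rewrite -mulrDr; apply: ler_wpM2l => //.
    (* The growth of the squared average is exactly what the tail of the series loses at time
       [i]. *)
    have := drift_avg D0 pG0 pG1 pGs (mean_edge_count P mA sA) (alpha i) x.
    rewrite -/E -/v; lra.
  (* The tail product loses the factor [1 + g i], which is the growth allowed by [drift_quad]. *)
  have KE : K i = (1 + g i) * K i.+1.
    rewrite /K /Pi big_ord_recr /= -/(Pi i); field.
    rewrite !gt_eqF //; last by rewrite ltr_wpDr.
  rewrite KE [leRHS]mulrA; apply: (ler_wpM2r (K0 i.+1)).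
  exact: (drift_quad D0 pG0 pG1 pGs (mean_edge_count P mA sA) x ME MlN Ml2 l10 lN0 (ltW (al0 i))).
have V_ge0 i x : 0 <= V i x by rewrite addr_ge0.
have := maximal_inequality D0 mA idA mnu unu indep mphi V_ge0 V_ge1 V_drift.
have -> : [set w | (a%:E < ereal_sup (range (fun j => (vnorm (qc_state D alpha A nu x0 j w))%:E)))%E]
  = \bigcup_n [set w | phi (qc_state D alpha A nu x0 n w)].
  apply/seteqP; split=> w /=.
    by move=> /ereal_sup_gtP[_ [j _ <-]]; rewrite lte_fin => h; exists j.
  move=> [j _ h]; apply/ereal_sup_gtP; exists (vnorm (qc_state D alpha A nu x0 j w))%:E; last by rewrite lte_fin.
  by exists j.
set U := \bigcup_n _ => PU.
have mU : measurable U by exact: bigcupT_measurable.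
rewrite /qc_bound -/M -/S2 -/(quad M x0) -/(avg x0) -/C -/g -/G.
set B := (X in Num.sqrt X).
(* The constants agree because 2 N v = 4 |M| D^2 / (3 N). *)
have BE : c * (avg x0 ^+ 2 + v * S2) = B / a ^+ 2.
  by rewrite /B /c /v; field; rewrite !gt_eqF.
have B0 : 0 <= B.
  have : 0 <= c * (avg x0 ^+ 2 + v * S2).
    by have := V1_ge0 0%N x0; rewrite big_ord0 subr0.
  by rewrite BE pmulr_lge0 // invr_gt0 exprn_gt0.
have VE : V 0%N x0 = B / a ^+ 2 + (1 + quad M x0) * G / C.
  by rewrite /V /K /Pi !big_ord0 subr0 BE divr1 mulrA.
have W0 : 0 <= (1 + quad M x0) * G / C by rewrite divr_ge0 ?mulr_ge0 ?(ltW C0) ?(ltW G0) ?addr_ge0 //.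
(* If the square-root term exceeds 1, so does the whole bound, the other term being nonnegative. *)
have [h|h] := leP (Num.sqrt B / a) 1.
  apply: (le_trans PU); rewrite VE lee_fin lerD2r.
  exact: ler_sqrt_ratio.
apply: (@le_trans _ _ 1%E); first exact: probability_le1.
by rewrite lee_fin; lra.
Qed.
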